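(* Let $\{\Phi_t\}_{t\ge0}$ be a quantum dynamical semigroup of unital quantum channels on $M_d$. Then there exists $t_0\ge0$ such that $\Phi_t$ is a mixed unitary channel for every $t\ge t_0$.
   Context: A quantum dynamical semigroup of unital quantum channels is a family $\{\Phi_t\}_{t\ge0}$ of completely positive, unital, trace-preserving linear maps on $M_d$ with $\Phi_0=\mathrm{id}$, $\Phi_s\Phi_t=\Phi_{s+t}$ and $t\mapsto\Phi_t$ continuous. A unital quantum channel is mixed unitary if it equals $\sum_{j=1}^\ell\lambda_j\mathrm{Ad}_{U_j}$ with unitaries $U_j$, $\lambda_j\ge0$, $\sum_j\lambda_j=1$, where $\mathrm{Ad}_U(X)=U^*XU$. *)

(* Defs.v *)
From HB Require Import structures.
From mathcomp Require Import all_boot all_order all_algebra.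
From mathcomp Require Import sesquilinear spectral.
From mathcomp Require Import complex.
From mathcomp Require Import all_classical all_reals all_analysis.

Set Implicit Arguments.
Unset Strict Implicit.
Unset Printing Implicit Defensive.

Import Order.TTheory GRing.Theory Num.Theory.
Local Open Scope ring_scope.
Local Open Scope complex_scope.
Local Open Scope sesquilinear_scope.
Import numFieldNormedType.Exports.
Local Open Scope classical_set_scope.

Section QDefs.
Variable R : realType.
Local Notation C := (R[i]).

Definition block_psd (d k : nat) (X : 'I_k -> 'I_k -> 'M[C]_d) : Prop :=
  forall v : 'I_k -> 'cV[C]_d,
    0 <= \sum_(i < k) \sum_(j < k) ((v i)^t* *m X i j *m v j) 0 0.

Definition is_linear_map (d : nat) (Phi : 'M[C]_d -> 'M[C]_d) : Prop :=
  forall (a : C) (X Y : 'M[C]_d), Phi (a *: X + Y) = a *: Phi X + Phi Y.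

(* completely positive: id_{M_k} (x) Phi is positive for every k *)
Definition completely_positive (d : nat) (Phi : 'M[C]_d -> 'M[C]_d) : Prop :=
  forall (k : nat) (X : 'I_k -> 'I_k -> 'M[C]_d),
    block_psd X -> block_psd (fun i j => Phi (X i j)).

Definition unital_map (d : nat) (Phi : 'M[C]_d -> 'M[C]_d) : Prop :=
  Phi 1%:M = 1%:M.

Definition trace_preserving (d : nat) (Phi : 'M[C]_d -> 'M[C]_d) : Prop :=
  forall X : 'M[C]_d, \tr (Phi X) = \tr X.

Definition unital_channel (d : nat) (Phi : 'M[C]_d -> 'M[C]_d) : Prop :=
  [/\ is_linear_map Phi, completely_positive Phi, unital_map Phi
    & trace_preserving Phi].

Definition Ad (d : nat) (U : 'M[C]_d) (X : 'M[C]_d) : 'M[C]_d :=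
  U^t* *m X *m U.

Definition mixed_unitary (d : nat) (Phi : 'M[C]_d -> 'M[C]_d) : Prop :=
  unital_channel Phi /\
  exists (l : nat) (lam : 'I_l -> C) (U : 'I_l -> 'M[C]_d),
    [/\ forall j, 0 <= lam j,
        \sum_(j < l) lam j = 1,
        forall j, U j \is unitarymx
      & forall X, Phi X = \sum_(j < l) lam j *: Ad (U j) X].

(* Continuity of t |-> Phi_t (finite-dimensional, so entrywise, real and *)
(* imaginary parts) on [0, +oo).                                          *)
Definition unital_QDS (d : nat) (Phi : R -> 'M[C]_d -> 'M[C]_d) : Prop :=
  [/\ forall t, 0 <= t -> unital_channel (Phi t),
      forall X, Phi 0 X = X,
      forall s t X, 0 <= s -> 0 <= t -> Phi s (Phi t X) = Phi (s + t) X
    & forall (X : 'M[C]_d) (i j : 'I_d),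
        {within `[0, +oo[, continuous (fun t => complex.Re (Phi t X i j))} /\
        {within `[0, +oo[, continuous (fun t => complex.Im (Phi t X i j))}].

End QDefs.

(* Main.v *)
(* Let N be the space of matrices whose Hilbert-Schmidt norm is preserved by
   every Phi_t, and let B be its commutant.  By equality in Kadison-Schwarz, each
   Kraus operator K of Phi_t satisfies K Phi_t(X) = X K on N.  For small t a
   combination of them is close to the identity, so its polar part is a unitary
   U_t with Phi_t(X) = U_t^* X U_t on N; powers give this for all t.  Hence
   Psi_t = U_t Phi_t(.) U_t^* is a unital channel with Kraus operators in B, and
   since Phi_t contracts the orthogonal complement of N to 0, Psi_t tends to the
   orthogonal projection T onto N.
   T is an average of conjugations X |-> U^* X U by unitaries of B, and it is an
   interior point (in the affine span) of their convex hull: every unital channel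
   with Kraus operators in B lies in the linear span of these conjugations.  By
   duality this says that a sesquilinear form f on B with f(u, u) = 0 for all
   unitaries u of B satisfies sum_a f(K_a, K_a) = 0 whenever
   sum_a K_a^* K_a = sum_a K_a K_a^* = 1, which is checked on matrix units. *)

(* Closeness of Psi_t to T is not sufficient by itself: conjugations span in general a proper
   subspace of all maps, and Psi_t - T has to lie in it. This is why the algebraic duality statement
   is needed. It holds because a form vanishing on the unitaries is, on B, a linear function of x^*
   y plus a linear function of y x^*; the unital and trace-preserving conditions evaluate these two
   functions at the identity. Interiority of T comes from absorption: T followed by conjugation by a
   unitary of B is again T. Hence T can be rewritten as a mixture giving positive weight to any
   prescribed finite family of conjugations, and small negative coefficients disappear in these
   weights. The unitary U_t is removed because Phi_t may rotate N forever and then has no limit. At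
   large times the combination of Kraus operators could be singular, so unitaries are built at small
   times and multiplied. The neighbourhood of T depends on B alone, so U_t can be chosen separately
   for each t. *)
Require Import Defs.
From HB Require Import structures.
From mathcomp Require Import all_boot all_order all_algebra all_fingroup.
From mathcomp Require Import sesquilinear spectral ring lra.
From mathcomp Require Import complex.
From mathcomp Require Import all_classical all_reals all_analysis.
Set Implicit Arguments.
Unset Strict Implicit.
Unset Printing Implicit Defensive.
Import Order.TTheory GRing.Theory Num.Theory.
Import numFieldNormedType.Exports.
Local Open Scope ring_scope.
Local Open Scope sesquilinear_scope.

(** * Adjoints, Hilbert-Schmidt norm, functional calculus *)

(* Functional calculus for normal [H]; on other matrices the spectral data are
   junk.  Locked because rewriting with [mulmxA] would unfold it. *)
HB.lock Definition mxfun (C : numClosedFieldType) n (f : C -> C) (H : 'M[C]_n) :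
    'M[C]_n :=
  (spectralmx H)^t* *m diag_mx (map_mx f (spectral_diag H)) *m spectralmx H.

Section Adjoint.
Variable C : numClosedFieldType.

Lemma adjM m n p (A : 'M[C]_(m, n)) (B : 'M[C]_(n, p)) :
  (A *m B)^t* = B^t* *m A^t*.
Proof. by rewrite trmx_mul map_mxM. Qed.

Lemma adjD m n (A B : 'M[C]_(m, n)) : (A + B)^t* = A^t* + B^t*.
Proof. by rewrite linearD /= map_mxD. Qed.

Lemma adjN m n (A : 'M[C]_(m, n)) : (- A)^t* = - A^t*.
Proof. by rewrite linearN /= map_mxN. Qed.

Lemma adjB m n (A B : 'M[C]_(m, n)) : (A - B)^t* = A^t* - B^t*.
Proof. by rewrite adjD adjN. Qed.

Lemma adjZ m n (a : C) (A : 'M[C]_(m, n)) : (a *: A)^t* = a^* *: A^t*.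
Proof. by rewrite linearZ /= map_mxZ. Qed.

Lemma adj0 m n : (0 : 'M[C]_(m, n))^t* = 0.
Proof. by rewrite linear0 map_mx0. Qed.

Lemma adj1 n : (1%:M : 'M[C]_n)^t* = 1%:M.
Proof. by rewrite trmx1 map_mx1. Qed.

Lemma adj_sum m n I (r : seq I) (P : pred I) (F : I -> 'M[C]_(m, n)) :
  (\sum_(i <- r | P i) F i)^t* = \sum_(i <- r | P i) (F i)^t*.
Proof.
by apply: (big_morph (fun A : 'M[C]_(m, n) => A^t*)) => [A B|];
  rewrite (adjD, adj0).
Qed.

Lemma adj_inj m n (A B : 'M[C]_(m, n)) : A^t* = B^t* -> A = B.
Proof. by move=> e; rewrite -[A]trmxCK e trmxCK. Qed.

Lemma unitary_adjL n (U : 'M[C]_n) : U \is unitarymx -> U^t* *m U = 1%:M.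
Proof. by move=> /unitarymxP/mulmx1C. Qed.

Lemma unitaryP n (U : 'M[C]_n) : U^t* *m U = 1%:M -> U \is unitarymx.
Proof. by move=> /mulmx1C/unitarymxP. Qed.

Lemma mul_delta_entry m n p q (A : 'M[C]_(m, n)) (B : 'M[C]_(p, q)) i j a b :
  (A *m delta_mx i j *m B) a b = A a i * B j b.
Proof.
rewrite mxE (bigD1 j) //= big1 ?addr0 => [|k /negPf kj]; last first.
  by rewrite mxE big1 ?mul0r // => l _; rewrite mxE kj andbF mulr0.
rewrite mxE (bigD1 i) //= big1 ?addr0 => [|l /negPf li].
  by rewrite mxE !eqxx mulr1.
by rewrite mxE li mulr0.
Qed.

Definition hsn m n (A : 'M[C]_(m, n)) : C := \tr (A^t* *m A).

Lemma hsnE m n (A : 'M[C]_(m, n)) : hsn A = \sum_j \sum_i `|A i j| ^+ 2.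
Proof.
apply: eq_bigr => j _; rewrite mxE; apply: eq_bigr => i _.
by rewrite !mxE normCK mulrC.
Qed.

Lemma hsn_ge0 m n (A : 'M[C]_(m, n)) : 0 <= hsn A.
Proof. by rewrite hsnE; do 2!apply: sumr_ge0 => ? _; rewrite exprn_ge0. Qed.

Lemma hsn_eq0 m n (A : 'M[C]_(m, n)) : hsn A = 0 -> A = 0.
Proof.
move=> h0; apply/matrixP => i j; rewrite mxE.
have: \sum_j \sum_i `|A i j| ^+ 2 = 0 by rewrite -hsnE.
move/psumr_eq0P => /(_ (fun k _ => sumr_ge0 _ (fun l _ => exprn_ge0 2 (normr_ge0 _)))).
move/(_ j isT)/psumr_eq0P => /(_ (fun k _ => exprn_ge0 2 (normr_ge0 _)) i isT).
by move/eqP; rewrite expf_eq0 /= normr_eq0 => /eqP.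
Qed.

Lemma hsn_sum_eq0 m n (I : finType) (F : I -> 'M[C]_(m, n)) :
  \sum_i hsn (F i) = 0 -> forall i, F i = 0.
Proof.
move=> /psumr_eq0P h i; apply: hsn_eq0; apply: h => // j _; exact: hsn_ge0.
Qed.

Lemma hsn_unitaryl m n (U : 'M[C]_m) (A : 'M[C]_(m, n)) :
  U \is unitarymx -> hsn (U *m A) = hsn A.
Proof.
by move=> uU; rewrite /hsn adjM mulmxA -(mulmxA (A^t*)) unitary_adjL // mulmx1.
Qed.

Lemma hsn_unitaryr m n (U : 'M[C]_n) (A : 'M[C]_(m, n)) :
  U \is unitarymx -> hsn (A *m U) = hsn A.
Proof.
move=> uU; rewrite /hsn adjM !mulmxA mxtrace_mulC !mulmxA.
by rewrite (unitarymxP uU) mul1mx.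
Qed.

(** Polarization: reality of the form at [x + y] and at [x + 'i *: y] gives the sum and the
    difference of the two mixed values, hence their conjugate symmetry. *)
Lemma psd_hermitian n (J : 'M[C]_n) :
  (forall x : 'rV[C]_n, 0 <= (x *m J *m x^t*) 0 0) -> J^t* = J.
Proof.
move=> psd; pose q (x y : 'rV[C]_n) := (x *m J *m y^t*) 0 0.
have qD x y z : q (x + y) z = q x z + q y z.
  by rewrite /q !mulmxDl mxE.
have qDr x y z : q z (x + y) = q z x + q z y.
  by rewrite /q adjD !mulmxDr mxE.
have qZ a x z : q (a *: x) z = a * q x z by rewrite /q -!scalemxAl mxE.
have qZr a x z : q z (a *: x) = a^* * q z x by rewrite /q adjZ -!scalemxAr mxE.
have qr x : (q x x)^* = q x x by apply/conj_Creal/ger0_real/psd.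
have pol x y : (q x y)^* = q y x.
  have := qr (x + y); rewrite !(qD, qDr) !rmorphD /= !qr => h1.
  have := qr (x + 'i *: y); rewrite !(qD, qDr, qZ, qZr) !rmorphD !rmorphM /= !qr.
  rewrite conjCK conjCi => h2.
  move: h1 h2; set a' := (q x y)^*; set b' := (q y x)^*.
  set a := q x y; set b := q y x; set X := q x x; set Y := q y y => h1 h2.
  have e1 : a' + b' = a + b.
    apply: (addrI (X + Y)); transitivity (X + a' + (b' + Y)); first by ring.
    by rewrite h1; ring.
  have e2 : a' - b' = b - a.
    apply: (mulfI (neq0Ci C)); apply: (addrI (X + 'i * - 'i * Y)).
    transitivity (X + 'i * a' + (- 'i * b' + - 'i * ('i * Y))); first by ring.
    by rewrite h2; ring.
  apply: (@mulIf _ 2%:R); first by rewrite pnatr_eq0.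
  transitivity ((a' + b') + (a' - b')); first by ring.
  by rewrite e1 e2; ring.
apply/matrixP => i j; rewrite !mxE.
have qE k l : q (delta_mx 0 k) (delta_mx 0 l) = J k l.
  rewrite /q -rowE !mxE (bigD1 l) //= !mxE !eqxx conjC1 mulr1 big1 ?addr0 //.
  by move=> m /negPf ml; rewrite !mxE ml andbF conjC0 mulr0.
by rewrite -!qE pol.
Qed.

Lemma normalmx_adj n (H : 'M[C]_n) : H^t* = H -> H \is normalmx.
Proof. by move=> h; apply/normalmxP; rewrite h. Qed.

Section FunctionalCalculus.
Variable n : nat.
Implicit Types (H X : 'M[C]_n) (f g : C -> C).

Lemma mxfun_id H : H^t* = H -> mxfun id H = H.
Proof.
move=> Hh; have /orthomx_spectralP e := normalmx_adj Hh; rewrite [RHS]e.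
rewrite mxfun.unlock [map_mx id _]map_mx_id //.
by rewrite invmx_unitary ?spectral_unitarymx.
Qed.

Lemma mxfun_ext f g H :
  (forall i, f (spectral_diag H 0 i) = g (spectral_diag H 0 i)) ->
  mxfun f H = mxfun g H.
Proof.
move=> fg; rewrite mxfun.unlock; congr (_ *m diag_mx _ *m _).
by apply/rowP => i; rewrite !mxE fg.
Qed.

Lemma mxfunM f g H : mxfun f H *m mxfun g H = mxfun (fun x => f x * g x) H.
Proof.
rewrite mxfun.unlock !mulmxA -(mulmxA _ (spectralmx H)).
rewrite (unitarymxP (spectral_unitarymx H)) mulmx1.
rewrite -(mulmxA ((spectralmx H)^t*) (diag_mx _)) mulmx_diag.
by congr (_ *m diag_mx _ *m _); apply/rowP => i; rewrite !mxE.
Qed.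

Lemma mxfun1 H : mxfun (fun=> 1) H = 1%:M.
Proof.
rewrite mxfun.unlock (_ : map_mx (fun=> 1) _ = const_mx 1);
  last by apply/rowP => i; rewrite !mxE.
by rewrite diag_const_mx mulmx1 unitary_adjL // spectral_unitarymx.
Qed.

Lemma mxfun_adj f H : (mxfun f H)^t* = mxfun (fun x => (f x)^*) H.
Proof.
rewrite mxfun.unlock !adjM trmxCK mulmxA tr_diag_mx map_diag_mx.
by congr (_ *m diag_mx _ *m _); apply/rowP => i; rewrite !mxE.
Qed.

Lemma mxfun_sum I (r : seq I) (P : pred I) (F : I -> C -> C) H :
  \sum_(i <- r | P i) mxfun (F i) H = mxfun (fun x => \sum_(i <- r | P i) F i x) H.
Proof.
rewrite mxfun.unlock -mulmx_suml -mulmx_sumr; congr (_ *m _ *m _).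
apply/matrixP => k l; rewrite summxE !mxE.
by rewrite -sumrMnl; apply: eq_bigr => i _; rewrite !mxE.
Qed.

Lemma mxfunZ f a H : mxfun (fun x => a * f x) H = a *: mxfun f H.
Proof.
rewrite mxfun.unlock scalemxAl scalemxAr; congr (_ *m _ *m _).
by apply/matrixP => k l; rewrite !mxE mulrnAr.
Qed.

(** In an eigenbasis of [H], commuting with [H] means that the entry at [i, j] vanishes unless the
    two eigenvalues agree, and then their images under [f] agree as well. *)
Lemma mxfun_comm f H X : H^t* = H ->
  X *m H = H *m X -> X *m mxfun f H = mxfun f H *m X.
Proof.
move=> Hh; rewrite -{1 2}(mxfun_id Hh) mxfun.unlock [map_mx id _]map_mx_id //.
set V := spectralmx H; set D := spectral_diag H => XH.
have VV : V *m V^t* = 1%:M by apply/unitarymxP/spectral_unitarymx.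
have VV' := mulmx1C VV.
pose Z := V *m X *m V^t*.
have ZD : Z *m diag_mx D = diag_mx D *m Z.
  rewrite /Z -[LHS]mulmx1 -VV !mulmxA.
  have := congr1 (fun M => V *m M *m V^t*) XH; rewrite !mulmxA => ->.
  by rewrite VV mul1mx.
have /(congr1 (fun M => V^t* *m M *m V)) :
    Z *m diag_mx (map_mx f D) = diag_mx (map_mx f D) *m Z.
  move: (Z) ZD => Y YD; rewrite mul_mx_diag mul_diag_mx.
  apply/matrixP => i j; rewrite !mxE.
  have YE : Y i j * D 0 j = D 0 i * Y i j.
    by move/matrixP: YD => /(_ i j); rewrite mul_mx_diag mul_diag_mx !mxE.
  case: (eqVneq (Y i j) 0) => [->|y0]; first by rewrite mul0r mulr0.
  by rewrite mulrC; congr (f _ * _); apply: (mulIf y0); rewrite mulrC YE.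
rewrite /Z !mulmxA VV' mul1mx.
by rewrite -!(mulmxA _ (V^t*) V) VV' !mulmx1.
Qed.

Lemma spectral_row H i : H^t* = H ->
  row i (spectralmx H) *m H = spectral_diag H 0 i *: row i (spectralmx H).
Proof.
move=> Hh; rewrite -{2}(mxfun_id Hh) mxfun.unlock [map_mx id _]map_mx_id // !mulmxA
  -row_mul.
rewrite (unitarymxP (spectral_unitarymx H)) -!row_mul mul1mx.
by rewrite row_mul row_diag_mx -scalemxAl -rowE.
Qed.

Lemma spectral_row_norm H i :
  row i (spectralmx H) *m (row i (spectralmx H))^t* = 1%:M.
Proof.
have /matrixP/(_ i i) := unitarymxP (spectral_unitarymx H).
rewrite !mxE eqxx => e; apply/matrixP => a b; rewrite !ord1 !mxE -e.
by apply: eq_bigr => k _; rewrite !mxE.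
Qed.

Lemma spectral_diagE H i : H^t* = H ->
  spectral_diag H 0 i =
  (row i (spectralmx H) *m H *m (row i (spectralmx H))^t*) 0 0.
Proof. by move=> Hh; rewrite spectral_row // -scalemxAl spectral_row_norm !mxE
  mulr1. Qed.

End FunctionalCalculus.
End Adjoint.

(** * Kraus operators *)

Section Kraus.
Variable C : numClosedFieldType.

(** The adjoint stands on the left, as in [Ad]. So unitality reads as the sum of [(K i)^t* *m K i]
    being 1, and trace preservation as the sum of [K i *m (K i)^t*] being 1. *)
Definition kraus n (I : finType) (K : I -> 'M[C]_n) (X : 'M[C]_n) : 'M[C]_n :=
  \sum_i (K i)^t* *m X *m K i.

Lemma krausE n (I : finType) (K : I -> 'M[C]_n) X a b :
  kraus K X a b = \sum_i \sum_k \sum_l (K i k a)^* * X k l * K i l b.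
Proof.
rewrite summxE; apply: eq_bigr => i _; rewrite mxE.
under eq_bigr => l _ do rewrite mxE mulr_suml.
rewrite exchange_big; apply: eq_bigr => k _; apply: eq_bigr => l _.
by rewrite !mxE.
Qed.

(** Choi's theorem. The second hypothesis is positivity of the Choi matrix [J], indexed by pairs;
    its eigenvectors, scaled by square roots of eigenvalues and reshaped, are the Kraus
    operators. *)
Lemma kraus_decomposition n (Phi : 'M[C]_n -> 'M[C]_n) :
  (forall X, Phi X = \sum_i \sum_j X i j *: Phi (delta_mx i j)) ->
  (forall v : 'I_n -> 'cV[C]_n,
    0 <= \sum_i \sum_j ((v i)^t* *m Phi (delta_mx i j) *m v j) 0 0) ->
  exists (m : nat) (K : 'I_m -> 'M[C]_n), forall X, Phi X = kraus K X.
Proof.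
move=> lin pos; pose N := #|{: 'I_n * 'I_n}|.
pose J : 'M[C]_N := \matrix_(p, q)
  Phi (delta_mx (enum_val p).1 (enum_val q).1) (enum_val p).2 (enum_val q).2.
have Jpos (x : 'rV[C]_N) : 0 <= (x *m J *m x^t*) 0 0.
  (* Conjugated because [J] is tested on row vectors with the adjoint on the right, block positivity
     on columns with the adjoint on the left. *)
  pose v i : 'cV[C]_n := \col_a (x 0 (enum_rank (i, a)))^*.
  rewrite (_ : _ 0 0 = \sum_i \sum_j ((v i)^t* *m Phi (delta_mx i j) *m v j) 0 0) //.
  have bij : {on [pred _ | true], bijective (@enum_rank ('I_n * 'I_n)%type)}.
    exact/onW_bij/enum_rank_bij.
  transitivity (\sum_(q : 'I_n * 'I_n) \sum_(p : 'I_n * 'I_n)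
     x 0 (enum_rank p) * Phi (delta_mx p.1 q.1) p.2 q.2 * (x 0 (enum_rank q))^*).
    rewrite mxE (reindex _ bij); apply: eq_bigr => q _; rewrite !mxE.
    rewrite (reindex _ bij) /= mulr_suml; apply: eq_bigr => p _.
    by rewrite !mxE !enum_rankK.
  transitivity (\sum_j \sum_b \sum_i \sum_a x 0 (enum_rank (i, a)) *
    Phi (delta_mx i j) a b * (x 0 (enum_rank (j, b)))^*).
    rewrite [RHS]pair_bigA; apply: eq_bigr => -[j b] _ /=.
    by rewrite [RHS]pair_bigA; apply: eq_bigr => -[].
  rewrite [RHS]exchange_big /=; apply: eq_bigr => j _.
  rewrite exchange_big /=; apply: eq_bigr => i _; rewrite mxE.
  apply: eq_bigr => b _; rewrite !mxE mulr_suml; apply: eq_bigr => a _.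
  by rewrite !mxE conjCK.
have Jh := psd_hermitian Jpos.
set V := spectralmx J; set D := spectral_diag J.
have D_ge0 m : 0 <= D 0 m by rewrite /D spectral_diagE.
have JE p q : J p q = \sum_m (V m p)^* * D 0 m * V m q.
  rewrite -{1}(mxfun_id Jh) mxfun.unlock mxE; apply: eq_bigr => m _.
  by rewrite mul_mx_diag !mxE.
exists N, (fun m => \matrix_(i, a) (sqrtC (D 0 m) * V m (enum_rank (i, a)))) => X.
apply/matrixP => a b; rewrite krausE lin summxE.
under eq_bigr do rewrite summxE.
rewrite [RHS]exchange_big /=; apply: eq_bigr => i _.
rewrite [RHS]exchange_big /=; apply: eq_bigr => j _.
rewrite mxE.
have := JE (enum_rank (i, a)) (enum_rank (j, b)); rewrite mxE !enum_rankK /= => ->.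
rewrite mulr_sumr; apply: eq_bigr => m _; rewrite !mxE rmorphM /=.
have -> : (sqrtC (D 0 m))^* = sqrtC (D 0 m).
  by apply/conj_Creal/ger0_real; rewrite sqrtC_ge0.
by rewrite -[in LHS](sqrtCK (D 0 m)); ring.
Qed.

(** * Hilbert-Schmidt contraction and its equality case *)

Section Channel.
Variables (n : nat) (I : finType) (K : I -> 'M[C]_n).
Hypothesis Ku : \sum_i (K i)^t* *m K i = 1%:M.
Hypothesis Kt : \sum_i K i *m (K i)^t* = 1%:M.
Implicit Types X Y : 'M[C]_n.

Lemma kraus_adj X : (kraus K X)^t* = kraus K (X^t*).
Proof.
by rewrite adj_sum; apply: eq_bigr => i _; rewrite !adjM trmxCK mulmxA.
Qed.

(** An exact sum of squares for the defect of contraction: after expansion, [Ku] and [Kt] evaluate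
    the two square terms, and each mixed term is [hsn (kraus K X)]. *)
Lemma kadison_schwarz X :
  \sum_i hsn (K i *m kraus K X - X *m K i) = hsn X - hsn (kraus K X).
Proof.
set Y := kraus K X.
have E i : hsn (K i *m Y - X *m K i) =
    (\tr (Y^t* *m ((K i)^t* *m K i) *m Y) - \tr (((K i)^t* *m X^t* *m K i) *m Y))
    - (\tr (Y^t* *m ((K i)^t* *m X *m K i)) - \tr (X^t* *m X *m (K i *m (K i)^t*))).
  have trB (M P : 'M[C]_n) : \tr (M - P) = \tr M - \tr P by exact: linearB.
  rewrite /hsn adjB !adjM mulmxBr !mulmxBl !trB !mulmxA.
  congr (_ - _ - (_ - _)).
  by rewrite -!mulmxA mxtrace_mulC !mulmxA.
under eq_bigr do rewrite E.
rewrite !sumrB -!linear_sum /= -!mulmx_suml -!mulmx_sumr Ku Kt !mulmx1.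
have -> : \sum_i (K i)^t* *m X^t* *m K i = Y^t* by rewrite kraus_adj.
rewrite -/(kraus K X) -/Y /hsn; ring.
Qed.

Lemma kraus_contraction X : hsn (kraus K X) <= hsn X.
Proof.
by rewrite -subr_ge0 -kadison_schwarz; apply: sumr_ge0 => i _; exact: hsn_ge0.
Qed.

Lemma kraus_isometric X i : hsn (kraus K X) = hsn X ->
  K i *m kraus K X = X *m K i.
Proof.
move=> e; apply/eqP; rewrite -subr_eq0; apply/eqP; move: i.
by apply: hsn_sum_eq0; rewrite kadison_schwarz e subrr.
Qed.

Lemma kraus_intertwine X Y : (forall i, K i *m Y = X *m K i) -> kraus K X = Y.
Proof.
move=> h; rewrite /kraus; under eq_bigr do rewrite -mulmxA -h mulmxA.
by rewrite -mulmx_suml Ku mul1mx.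
Qed.

End Channel.
End Kraus.

(** * Matrix units of a *-algebra *)

Section MatrixUnits.
Variables (C : numClosedFieldType) (n : nat).
Implicit Types (B : 'M[C]_n -> Prop) (p q h : 'M[C]_n).

(** The field [sa_fun] supplies the spectral projections of hermitian elements; for a commutant it
    is [mxfun_comm]. *)
Record star_algebra B : Prop := StarAlgebra {
  sa_one : B 1%:M;
  sa_add : forall x y, B x -> B y -> B (x + y);
  sa_scale : forall a x, B x -> B (a *: x);
  sa_mul : forall x y, B x -> B y -> B (x *m y);
  sa_adj : forall x, B x -> B (x^t*);
  sa_fun : forall f h, h^t* = h -> B h -> B (mxfun f h) }.

Lemma commutant_star_algebra (N : 'M[C]_n -> Prop) :
  (forall X, N X -> N (X^t*)) ->
  star_algebra (fun b => forall X, N X -> X *m b = b *m X).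
Proof.
move=> Nadj; split=> [X _|x y hx hy X NX|a x hx X NX|x y hx hy X NX|x hx X NX|f h
  hh hx X NX].
- by rewrite mulmx1 mul1mx.
- by rewrite mulmxDr mulmxDl hx // hy.
- by rewrite -scalemxAr -scalemxAl hx.
- by rewrite mulmxA hx // -mulmxA hy // mulmxA.
- by apply: adj_inj; rewrite !adjM trmxCK -hx //; exact: Nadj.
- by apply: mxfun_comm => //; exact: hx.
Qed.

(** The decomposition of a *-algebra into full matrix blocks, with one index set for all blocks:
    [c i] is the chosen representative of the block of [i], and [v i j] is zero across blocks. *)
Record mxunits B r (c : 'I_r -> 'I_r) (v : 'I_r -> 'I_r -> 'M[C]_n) : Prop :=
  MxUnits {
  mu_in : forall i j, B (v i j);
  mu_adj : forall i j, (v i j)^t* = v j i;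
  mu_mul : forall i j k l,
    v i j *m v k l = if (c i == c j) && (j == k) then v i l else 0;
  mu_off : forall i j, c i != c j -> v i j = 0;
  mu_rep : forall i, c (c i) = c i;
  mu_sum : \sum_i v i i = 1%:M;
  mu_span : forall b, B b -> exists beta : 'I_r -> 'I_r -> C,
    b = \sum_i \sum_j beta i j *: v i j }.

Section Construction.
Variable B : 'M[C]_n -> Prop.
Hypothesis saB : star_algebra B.

Definition projection p := [/\ B p, p^t* = p & p *m p = p].
(** Minimality in the form in which it yields scalars: compression by [p] maps [B] to multiples of
    [p]. *)
Definition minimal_projection p :=
  [/\ projection p, p != 0 & forall k, B k -> exists c, p *m k *m p = c *: p].

Lemma sa0 : B 0.
Proof. by rewrite -(scale0r 1%:M); apply: (sa_scale saB) => //;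
  exact: (sa_one saB). Qed.

Lemma sa_opp x : B x -> B (- x).
Proof. by rewrite -scaleN1r; exact: (sa_scale saB). Qed.

Lemma sa_sum (I : Type) (s : seq I) (P : pred I) (F : I -> 'M[C]_n) :
  (forall i, P i -> B (F i)) -> B (\sum_(i <- s | P i) F i).
Proof. by move=> h; apply: big_ind => //; [exact: sa0 | exact: (sa_add saB)]. Qed.

(** The spectral projections of a hermitian [h] in the corner of [p], cut by [p], are
    subprojections, hence 0 or [p]. One of them is [p], so [h] has a single eigenvalue there; the
    general case follows from real and imaginary parts. *)
Lemma minimal_of_indecomposable p : projection p -> p != 0 ->
  (forall q, projection q -> p *m q = q -> q *m p = q -> q = 0 \/ q = p) ->
  minimal_projection p.
Proof.
move=> [Bp pa pp] p0 ind; split=> //.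
have hermitian_scalar h : B h -> h^t* = h -> p *m h = h -> h *m p = h ->
    exists c, h = c *: p.
  move=> Bh ha ph hp.
  have comm f : p *m mxfun f h = mxfun f h *m p.
    by apply: mxfun_comm; rewrite // ph.
  pose e m x : C := (x == spectral_diag h 0 m)%:R.
  pose q m := mxfun (e m) h *m p.
  have q0p m : q m = 0 \/ q m = p.
    apply: ind; rewrite /q; [split| |].
    - by apply: (sa_mul saB) => //; exact: (sa_fun saB).
    - rewrite adjM pa mxfun_adj comm; congr (_ *m _).
      by apply: mxfun_ext => i; rewrite /e conjC_nat.
    - rewrite -mulmxA (mulmxA p) comm -!mulmxA pp mulmxA.
      rewrite mxfunM; congr (_ *m _).
      by apply: mxfun_ext => i; rewrite /e; case: eqP; rewrite ?mulr1 ?mulr0.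
    - by rewrite mulmxA comm -mulmxA pp.
    - by rewrite -mulmxA pp.
  have [m qm] : exists m, q m = p.
    apply: contrapT => /forallNP nqp.
    have q0 m : q m = 0 by case: (q0p m) => // /nqp.
    (* Repeated eigenvalues make this sum a multiplicity rather than 1. It is nonzero on the
       spectrum, so it can be inverted; if every [q m] were 0, then [p] would be 0. *)
    pose f x := \sum_m e m x.
    case/eqP: p0; rewrite -[p]mul1mx -(mxfun1 h).
    rewrite (@mxfun_ext _ _ _ (fun x => (f x)^-1 * f x)); last first.
      move=> i; rewrite mulVf // /f /e -natr_sum pnatr_eq0 sum_nat_eq0.
      by apply/forallPn; exists i; rewrite eqxx.
    rewrite -mxfunM -mulmxA -mxfun_sum mulmx_suml.
    by rewrite big1 ?mulmx0 // => i _; exact: q0.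
  exists (spectral_diag h 0 m); rewrite -[LHS]hp -{1}qm /q mulmxA.
  rewrite -{1}(mxfun_id ha) mxfunM -{2}qm /q scalemxAl -mxfunZ.
  congr (_ *m _); apply: mxfun_ext => i; rewrite /e.
  by case: eqP => [->|]; rewrite ?mulr1 ?mulr0.
move=> k Bk; pose a := p *m k *m p.
have Ba : B a by do 2!apply: (sa_mul saB) => //.
have aa : a^t* = p *m k^t* *m p by rewrite !adjM pa mulmxA.
have pra : p *m a = a by rewrite /a !mulmxA pp.
have apr : a *m p = a by rewrite /a -!mulmxA pp.
have pra' : p *m a^t* = a^t* by rewrite aa !mulmxA pp.
have apr' : a^t* *m p = a^t* by rewrite aa -!mulmxA pp.
have Ba' : B (a^t*) by exact: (sa_adj saB).
have [c1 h1] : exists c, a + a^t* = c *: p.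
  apply: (hermitian_scalar (a + a^t*)).
  - exact: (sa_add saB).
  - by rewrite adjD trmxCK addrC.
  - by rewrite mulmxDr pra pra'.
  - by rewrite mulmxDl apr apr'.
have [c2 h2] : exists c, 'i *: a - 'i *: a^t* = c *: p.
  apply: (hermitian_scalar ('i *: a - 'i *: a^t*)).
  - by apply: (sa_add saB); [exact: (sa_scale saB) | apply: sa_opp;
    exact: (sa_scale saB)].
  - by rewrite adjB !adjZ trmxCK conjCi !scaleNr opprK addrC.
  - by rewrite mulmxBr -!scalemxAr pra pra'.
  - by rewrite mulmxBl -!scalemxAl apr apr'.
exists ((c1 - 'i * c2) / 2%:R); rewrite -/a mulrC -scalerA scalerBl -scalerA -h1 -h2.
apply: (@scalerI _ _ 2%:R); first by rewrite pnatr_eq0.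
rewrite scalerA mulfV ?pnatr_eq0 // scale1r.
rewrite scalerBr !scalerA -expr2 sqrCi !scaleN1r.
by apply/matrixP => i j; rewrite !mxE; ring.
Qed.

(** A projection that is not minimal splits as [q + (p - q)] with both ranks strictly smaller,
    whence the induction on a bound [k] for the rank. *)
Lemma projection_decomposition k p : (\rank p <= k)%N -> projection p ->
  exists s : seq 'M[C]_n,
    [/\ forall x, x \in s -> [/\ minimal_projection x, p *m x = x & x *m p = x],
        pairwise (fun x y : 'M[C]_n => x *m y == 0) s & \sum_(x <- s) x = p].
Proof.
elim: k p => [|k IHk] p rkp prp.
  by move: rkp; rewrite leqn0 mxrank_eq0 => /eqP ->; exists [::]; rewrite big_nil.
have [->|p0] := eqVneq p 0; first by exists [::]; rewrite big_nil.
have [minp|nminp] := pselect (minimal_projection p).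
  exists [:: p]; rewrite big_seq1; split=> // x; rewrite inE => /eqP ->.
  by split=> //; case: prp.
have [q [prq pq qp q0 qnp]] : exists q,
    [/\ projection q, p *m q = q, q *m p = q, q != 0 & q != p].
  apply: contrapT => nq; apply: nminp; apply: minimal_of_indecomposable => //.
  move=> q prq pq qp; apply: contrapT => /not_orP [q0 qnp]; apply: nq.
  by exists q; split=> //; exact/eqP.
case: (prp) => Bp pa pp; case: (prq) => Bq qa qq.
have rk_lt x : p *m x = x -> x *m p = x -> x *m x = x -> x != p ->
    (\rank x < \rank p)%N.
  move=> px xp xx xnp; rewrite ltn_neqAle -{2}xp mxrankM_maxr andbT.
  have sxp : (x <= p)%MS by rewrite -xp submxMl.
  apply: contra xnp => rk.
  have /eqmxP/eqmx_sym/eqmxP/andP[/submxP[D pE] _] : (x == p)%MS.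
    by rewrite -(geq_leqif (mxrank_leqif_eq sxp)) (eqP rk).
  by rewrite -px pE -mulmxA xx.
pose q' := p - q.
have pq' : p *m q' = q' by rewrite mulmxBr pp pq.
have qp' : q' *m p = q' by rewrite mulmxBl pp qp.
have qq' : q' *m q' = q' by rewrite mulmxBr qp' mulmxBl pq qq subrr subr0.
have q'np : q' != p by rewrite -subr_eq0 addrAC subrr add0r oppr_eq0.
have [s1 [s1P s1o s1s]] := IHk q (leq_trans (rk_lt q pq qp qq qnp) rkp) prq.
have [|s2 [s2P s2o s2s]] := IHk q' (leq_trans (rk_lt q' pq' qp' qq' q'np) rkp).
  by split=> //; [apply: (sa_add saB) => //; exact: sa_opp | rewrite adjB pa qa].
exists (s1 ++ s2); split.
- move=> x; rewrite mem_cat => /orP[/s1P|/s2P] [mx qx xq]; split=> //.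
  + by rewrite -qx mulmxA pq.
  + by rewrite -xq -mulmxA qp.
  + by rewrite -qx mulmxA pq'.
  + by rewrite -xq -mulmxA qp'.
- rewrite pairwise_cat s1o s2o !andbT; apply/allrelP => x y /s1P[_ _ xq] /s2P[_ qy _].
  by rewrite -xq -qy -mulmxA (mulmxA q) mulmxBr qp qq subrr mul0mx mulmx0.
- by rewrite big_cat /= s1s s2s addrC subrK.
Qed.

(** Split 1 into minimal projections [p i] and call [i], [j] equivalent when [p i *m b *m p j] is
    nonzero for some [b] in [B]. Equivalent projections are joined by partial isometries; with [w i]
    joining [i] to its representative, the units are [w i *m (w j)^t*]. *)
Lemma star_algebra_mxunits : exists r (c : 'I_r -> 'I_r) v, mxunits B c v.
Proof.
have [|s [sP so ss]] := @projection_decomposition _ 1%:M (leqnn _).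
  by split; rewrite ?adj1 ?mulmx1 //; exact: (sa_one saB).
pose r := size s; pose p (i : 'I_r) := s`_i.
have minp i : minimal_projection (p i) by have [] := sP _ (mem_nth 0 (ltn_ord i)).
have Bp i : B (p i) by case: (minp i) => -[].
have pa i : (p i)^t* = p i by case: (minp i) => -[].
have pp i : p i *m p i = p i by case: (minp i) => -[].
have p0 i : p i != 0 by case: (minp i).
have pm i k : B k -> exists c, p i *m k *m p i = c *: p i.
  by case: (minp i) => _ _; apply.
have sump : \sum_i p i = 1%:M by rewrite -ss (big_nth 0) big_mkord.
have porth i j : i != j -> p i *m p j = 0.
  have lt_orth (k l : 'I_r) : (k < l)%N -> p k *m p l = 0.
    by move=> kl; apply/eqP/(pairwiseP 0 so); rewrite ?inE.
  rewrite -val_eqE neq_ltn => /orP[/lt_orth //|/lt_orth ji].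
  by apply: adj_inj; rewrite adjM !pa ji adj0.
pose e i j := `[< exists2 b, B b & p i *m b *m p j != 0 >].
have e_refl i : e i i.
  by apply/asboolP; exists 1%:M; [exact: (sa_one saB) | rewrite mulmx1 pp].
have e_sym i j : e i j -> e j i.
  move=> /asboolP[b Bb nz]; apply/asboolP; exists (b^t*); first exact: (sa_adj saB).
  apply: contra nz => /eqP z; apply/eqP; apply: adj_inj.
  by rewrite adj0 !adjM !pa mulmxA.
have link i j : e i j -> exists w,
    [/\ B w, p i *m w = w, w *m p j = w, w *m w^t* = p i & w^t* *m w = p j].
  move=> /asboolP[b Bb]; move def_a: (p i *m b *m p j) => a a0.
  have pia : p i *m a = a by rewrite -def_a !mulmxA pp.
  have apj : a *m p j = a by rewrite -def_a -mulmxA pp.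
  have Ba : B a by rewrite -def_a; do 2!apply: (sa_mul saB) => //.
  have hsn_gt0 (x : 'M[C]_n) : x != 0 -> 0 < hsn x.
    by move=> x0; rewrite lt_def hsn_ge0 andbT; apply: contra x0 => /eqP/hsn_eq0 ->.
  have [c ca] : exists c, a *m a^t* = c *: p i.
    have [|c cE] := pm i (a *m a^t*); first by apply: (sa_mul saB) => //;
      exact: (sa_adj saB).
    exists c; rewrite -cE !mulmxA pia -mulmxA -{1}(pa i) -adjM pia.
    by [].
  have c_gt0 : 0 < c.
    have := hsn_gt0 _ a0; rewrite /hsn mxtrace_mulC ca mxtraceZ.
    rewrite -{1}(pp i) -{1}(pa i) -/(hsn (p i)).
    by rewrite pmulr_lgt0 // hsn_gt0.
  have sc0 : sqrtC c != 0 by rewrite sqrtC_eq0 gt_eqF.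
  have scr : (sqrtC c)^-1^* = (sqrtC c)^-1.
    by apply/conj_Creal/ger0_real; rewrite invr_ge0 sqrtC_ge0 ltW.
  pose w := (sqrtC c)^-1 *: a.
  have piw : p i *m w = w by rewrite -scalemxAr pia.
  have wpj : w *m p j = w by rewrite -scalemxAl apj.
  have ww : w *m w^t* = p i.
    rewrite adjZ scr -scalemxAl -scalemxAr ca !scalerA.
    by rewrite -invfM -expr2 sqrtCK mulVf ?scale1r // gt_eqF.
  have Bw : B w by exact: (sa_scale saB).
  exists w; split=> //.
  have [|d dE] := pm j (w^t* *m w); first by apply: (sa_mul saB) => //;
    exact: (sa_adj saB).
  have {}dE : w^t* *m w = d *: p j.
    by rewrite -dE -!mulmxA wpj !mulmxA -{1}(pa j) -adjM wpj.
  (* The scalar [d] is therefore 0 or 1, and 0 would force [p i = 0]. *)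
  have: (w^t* *m w) *m (w^t* *m w) = w^t* *m w.
    by rewrite -mulmxA (mulmxA w) ww piw.
  rewrite dE -scalemxAl -scalemxAr pp scalerA => /eqP.
  rewrite -subr_eq0 -scalerBl scaler_eq0 (negPf (p0 j)) orbF -{3}[d]mulr1 -mulrBr.
  rewrite mulf_eq0 => /orP[/eqP d0|]; last by rewrite subr_eq0 => /eqP ->;
    rewrite scale1r.
  by move: (p0 i); rewrite -(pp i) -{1}ww -mulmxA -ww (mulmxA (w^t*)) dE d0 scale0r
    mul0mx mulmx0 eqxx.
have e_trans i j k : e i j -> e j k -> e i k.
  move=> /link[w [Bw piw wpj ww w'w]] /asboolP[b Bb nz]; apply/asboolP.
  exists (w *m b); first exact: (sa_mul saB).
  apply: contra nz => /eqP z; apply/eqP.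
  have -> : p j *m b *m p k = w^t* *m (p i *m (w *m b) *m p k).
    by rewrite !mulmxA -(mulmxA (w^t*)) piw w'w.
  by rewrite z mulmx0.
(* [pick] depends only on the predicate [e i], which equivalent indices share, so it chooses one
   representative per class; reflexivity keeps the default from occurring. *)
pose c i := odflt i [pick j | e i j].
have ec i : e i (c i).
  by rewrite /c; case: pickP => //= /(_ i); rewrite e_refl.
have eq_c i j : e i j -> c i = c j.
  move=> eij; rewrite /c (@eq_pick _ (e i) (e j)); last first.
    move=> k; apply/idP/idP; first exact: e_trans (e_sym _ _ eij).
    exact: e_trans eij.
  by case: pickP => //= /(_ j); rewrite e_refl.
have [w wP] := choice (fun i => link i (c i) (ec i)).
pose v i j := if c i == c j then w i *m (w j)^t* else 0.
have vii i : v i i = p i by rewrite /v eqxx; case: (wP i).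
exists r, c, v; split.
- move=> i j; rewrite /v; case: eqP => _; last exact: sa0.
  by apply: (sa_mul saB); [case: (wP i) | apply: (sa_adj saB); case: (wP j)].
- by move=> i j; rewrite /v eq_sym; case: eqP => _; rewrite ?adj0 // adjM trmxCK.
- move=> i j k l; rewrite /v; case: (c i =P c j) => [cij|_]; last by rewrite mul0mx.
  have [<-{k}|jk] := eqVneq j k; last first.
    case: eqP => _; rewrite ?mulmx0 //.
    have [_ pj _ _ _] := wP j; have [_ pk _ _ _] := wP k.
    by rewrite -pk -pj adjM pa -!mulmxA (mulmxA (p j)) porth // mul0mx !mulmx0.
  rewrite cij; case: eqP => _; last by rewrite mulmx0.
  have [_ _ wi _ _] := wP i; have [_ _ _ _ wj] := wP j.
  by rewrite mulmxA -(mulmxA (w i)) wj -cij wi.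
- by move=> i j /negPf; rewrite /v => ->.
- by move=> i; rewrite -(eq_c _ _ (ec i)).
- by under eq_bigr do rewrite vii.
- move=> b Bb.
  have coef i j : exists a, p i *m b *m p j = a *: v i j.
    rewrite /v; case: (c i =P c j) => [cij|cij]; last first.
      exists 0; rewrite scaler0; apply/eqP; apply: contrapT => /negP nz.
      by apply/cij/eq_c/asboolP; exists b.
    have [Bi _ wpi wi _] := wP i; have [Bj _ wpj wj _] := wP j.
    have [|a aE] := pm (c i) ((w i)^t* *m b *m w j).
      by do 2?apply: (sa_mul saB) => //; exact: (sa_adj saB).
    exists a.
    have E : (w i)^t* *m b *m w j = a *: p (c i).
      by rewrite -aE {2}cij -!mulmxA wpj !mulmxA -{1}(pa (c i)) -adjM wpi.
    rewrite -wi -wj.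
    have -> : w i *m (w i)^t* *m b *m (w j *m (w j)^t*) =
        w i *m ((w i)^t* *m b *m w j) *m (w j)^t* by rewrite !mulmxA.
    by rewrite E -scalemxAr wpi -scalemxAl.
  exists (fun i => projT1 (choice (coef i)));
    rewrite -[LHS]mul1mx -[LHS]mulmx1 -sump mulmx_suml mulmx_suml.
  apply: eq_bigr => i _; rewrite mulmx_sumr; apply: eq_bigr => j _.
  exact: (projT2 (choice (coef i)) j).
Qed.

End Construction.
End MatrixUnits.

(** * Sesquilinear forms vanishing on unitaries *)

Section Units.
Variables (C : numClosedFieldType) (n : nat) (B : 'M[C]_n -> Prop).
Hypothesis saB : star_algebra B.
Variables (r : nat) (c : 'I_r -> 'I_r) (v : 'I_r -> 'I_r -> 'M[C]_n).
Hypothesis muv : mxunits B c v.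
Implicit Types (i j k l : 'I_r) (X Y : 'M[C]_n) (s t : {perm 'I_r}).

(** Permutations preserving the blocks; exactly for these [perm_units] is used as a unitary
    permutation matrix inside [B]. *)
Definition class_perm (s : {perm 'I_r}) := [forall a, c (s a) == c a].

Definition perm_units (s : {perm 'I_r}) : 'M[C]_n := \sum_a v (s a) a.

Lemma class_permP s : reflect (forall a, c (s a) = c a) (class_perm s).
Proof. exact: 'forall_eqP. Qed.

Lemma class_perm_tperm i j : c i = c j -> class_perm (tperm i j).
Proof. by move=> e; apply/class_permP => a; case: tpermP => [->|->|]. Qed.

Lemma class_permM s t : class_perm s -> class_perm t -> class_perm (s * t)%g.
Proof.
by move=> /class_permP sP /class_permP tP; apply/class_permP => a; rewrite permM tP.
Qed.

Lemma class_permV s : class_perm s -> class_perm s^-1%g.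
Proof.
move=> /class_permP sP; apply/class_permP => a.
by rewrite -{2}(permKV s a) sP.
Qed.

Lemma perm_units_mul s i j : class_perm s -> perm_units s *m v i j = v (s i) j.
Proof.
move=> /class_permP sP; rewrite mulmx_suml (bigD1 i) //= big1 ?addr0.
  by rewrite (mu_mul muv) sP !eqxx.
by move=> a /negPf ai; rewrite (mu_mul muv) ai andbF.
Qed.

Lemma perm_units_in s : B (perm_units s).
Proof. by apply: (sa_sum saB) => i _; exact: mu_in muv _ _. Qed.

(** The order is reversed because products of permutations compose from left to right. *)
Lemma perm_unitsM s t : class_perm s ->
  perm_units s *m perm_units t = perm_units (t * s)%g.
Proof.
move=> sP; rewrite mulmx_sumr; apply: eq_bigr => a _.
by rewrite perm_units_mul // permM.
Qed.

Lemma perm_units1 : perm_units 1%g = 1%:M.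
Proof. by rewrite -(mu_sum muv); apply: eq_bigr => i _; rewrite perm1. Qed.

Lemma perm_units_adj s : (perm_units s)^t* = perm_units s^-1%g.
Proof.
rewrite adj_sum (reindex_inj (@perm_inj _ s^-1%g)) /=; apply: eq_bigr => a _.
by rewrite (mu_adj muv) permKV.
Qed.

Lemma perm_units_unitary s : class_perm s -> perm_units s \is unitarymx.
Proof.
move=> sP; apply: unitaryP; rewrite perm_units_adj perm_unitsM ?class_permV //.
by rewrite mulgV perm_units1.
Qed.

Lemma mul_perm_units s i j : class_perm s -> v i j *m perm_units s = v i (s^-1%g j).
Proof.
move=> sP; rewrite -{1}(invgK s) -perm_units_adj -(mu_adj muv) -adjM.
by rewrite perm_units_mul ?class_permV // (mu_adj muv).
Qed.

(* Cosine 3/5 and sine 4/5 avoid square roots. *)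
Definition rotation i k : 'M[C]_n :=
  1%:M + (3%:R / 5%:R - 1) *: (v i i + v k k) + (4%:R / 5%:R) *: (v k i - v i k).

Lemma rotation_in i k : B (rotation i k).
Proof.
have Bv := mu_in muv.
apply: (sa_add saB); [apply: (sa_add saB); first exact: sa_one|].
  by apply: (sa_scale saB); exact: (sa_add saB).
by apply: (sa_scale saB); apply: (sa_add saB) => //; exact: (sa_opp saB).
Qed.

Lemma rotation_unitary i k : i != k -> c i = c k -> rotation i k \is unitarymx.
Proof.
move=> ik cik; apply: unitaryP; rewrite /rotation.
set e := v i i + v k k; set s := v k i - v i k.
have [kif ikf] : (k == i) = false /\ (i == k) = false by rewrite eq_sym (negPf ik).
have ee : e *m e = e.
  by rewrite /e mulmxDl !mulmxDr !(mu_mul muv) !eqxx kif ikf !andbF addr0 add0r.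
have es : e *m s = s.
  rewrite /e /s mulmxDl !mulmxBr !(mu_mul muv) !eqxx kif ikf !andbF.
  by rewrite add0r subr0 addrC.
have se : s *m e = s.
  rewrite /e /s mulmxDr !mulmxBl !(mu_mul muv) !eqxx kif ikf cik eqxx !andbF.
  by rewrite sub0r subr0.
have ss : s *m s = - e.
  rewrite /e /s mulmxBr !mulmxBl !(mu_mul muv) !eqxx kif ikf cik eqxx !andbF.
  by rewrite sub0r subr0 opprD addrC.
have ea : e^t* = e by rewrite adjD !(mu_adj muv).
have sa : s^t* = - s by rewrite adjB !(mu_adj muv) opprB.
have real_frac m : (m%:R / 5%:R : C)^* = m%:R / 5%:R.
  by rewrite rmorphM fmorphV !rmorph_nat.
rewrite !adjD !adjZ ea sa adj1 rmorphB rmorph1 !real_frac.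
move: e s ee es se ss {ea sa} => e s ee es se ss.
rewrite !mulmxDl !mulmxDr -!scalemxAl -!scalemxAr !mulmx1 !mul1mx.
rewrite !mulNmx ee es se ss; apply/matrixP => x y; rewrite !mxE.
by field.
Qed.

Lemma rotation_mul i k j : i != k -> c i = c k ->
  (rotation i k *m v i j = (3%:R / 5%:R) *: v i j + (4%:R / 5%:R) *: v k j) *
  (rotation i k *m v k j = (3%:R / 5%:R) *: v k j - (4%:R / 5%:R) *: v i j).
Proof.
move=> ik cik; rewrite /rotation !mulmxDl -!scalemxAl !mulmxDl !mulNmx !mul1mx.
have [kif ikf] : (k == i) = false /\ (i == k) = false by rewrite eq_sym (negPf ik).
rewrite !(mu_mul muv) !eqxx kif ikf cik !eqxx !andbF.
by split; apply/matrixP => x y; rewrite !mxE; ring.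
Qed.

Lemma mul_rotation i k j : i != k -> c i = c k -> c j = c i ->
  (v j i *m rotation i k = (3%:R / 5%:R) *: v j i - (4%:R / 5%:R) *: v j k) *
  (v j k *m rotation i k = (3%:R / 5%:R) *: v j k + (4%:R / 5%:R) *: v j i).
Proof.
move=> ik cik cji; rewrite /rotation !mulmxDr -!scalemxAr !mulmxDr !mulmxN !mulmx1.
have [kif ikf] : (k == i) = false /\ (i == k) = false by rewrite eq_sym (negPf ik).
rewrite !(mu_mul muv) !eqxx kif ikf cji cik !eqxx !andbF.
by split; apply/matrixP => x y; rewrite !mxE; ring.
Qed.

Record sesquilinear (f : 'M[C]_n -> 'M[C]_n -> C) : Prop := Sesquilinear {
  sesquiDl : forall x y z, f (x + y) z = f x z + f y z;
  sesquiDr : forall x y z, f z (x + y) = f z x + f z y;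
  sesquiZl : forall a x z, f (a *: x) z = a^* * f x z;
  sesquiZr : forall a x z, f z (a *: x) = a * f z x }.

Lemma sesqui0l f z : sesquilinear f -> f 0 z = 0.
Proof. by move=> sf; rewrite -(scale0r 0) (sesquiZl sf) conjC0 mul0r. Qed.

Lemma sesqui0r f z : sesquilinear f -> f z 0 = 0.
Proof. by move=> sf; rewrite -(scale0r 0) (sesquiZr sf) mul0r. Qed.

Lemma sesquiBl f x y z : sesquilinear f -> f (x - y) z = f x z - f y z.
Proof.
by move=> sf; rewrite -scaleN1r (sesquiDl sf) (sesquiZl sf) rmorphN1 mulN1r.
Qed.

Lemma sesquiBr f x y z : sesquilinear f -> f z (x - y) = f z x - f z y.
Proof.
by move=> sf; rewrite -scaleN1r (sesquiDr sf) (sesquiZr sf) mulN1r.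
Qed.

Lemma sesqui_suml f I (s : seq I) (F : I -> 'M[C]_n) z : sesquilinear f ->
  f (\sum_(i <- s) F i) z = \sum_(i <- s) f (F i) z.
Proof.
move=> sf; apply: (big_morph (f^~ z)) => [x y|]; first exact: sesquiDl sf _ _ _.
exact: sesqui0l.
Qed.

Lemma sesqui_sumr f I (s : seq I) (F : I -> 'M[C]_n) z : sesquilinear f ->
  f z (\sum_(i <- s) F i) = \sum_(i <- s) f z (F i).
Proof.
move=> sf; apply: (big_morph (f z)) => [x y|]; first exact: sesquiDr sf _ _ _.
exact: sesqui0r.
Qed.

Definition unitary_null f := sesquilinear f /\
  forall u, B u -> u \is unitarymx -> f u u = 0.

(** Lets an identity proved for one position of matrix units be moved to others, by permutation
    matrices, or expanded, by rotations. *)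
Lemma unitary_null_mull f V : B V -> V \is unitarymx -> unitary_null f ->
  unitary_null (fun x y => f (V *m x) (V *m y)).
Proof.
move=> BV uV [[Dl Dr Zl Zr] f0]; split.
  by split=> *; rewrite ?mulmxDr -?scalemxAr ?Dl ?Dr ?Zl ?Zr.
move=> u Bu uu; apply: f0; first exact: (sa_mul saB).
exact: mul_unitarymx.
Qed.

Lemma unitary_null_mulr f V : B V -> V \is unitarymx -> unitary_null f ->
  unitary_null (fun x y => f (x *m V) (y *m V)).
Proof.
move=> BV uV [[Dl Dr Zl Zr] f0]; split.
  by split=> *; rewrite ?mulmxDl -?scalemxAl ?Dl ?Dr ?Zl ?Zr.
move=> u Bu uu; apply: f0; first exact: (sa_mul saB).
exact: mul_unitarymx.
Qed.

(** Evaluate [f] at the unitaries [v i i + y *: v k k + w *: q]. Averaging over [w = 1, -1] removes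
    the mixed terms with [q]; the values [y = 1, -1, 'i] then isolate the coefficient of [y]. *)
Lemma unitary_null_diag f i k : unitary_null f -> i != k -> f (v i i) (v k k) = 0.
Proof.
move=> [sf f0] ik; set q := 1%:M - v i i - v k k.
have [kif ikf] : (k == i) = false /\ (i == k) = false by rewrite eq_sym (negPf ik).
have Bv := mu_in muv.
have Bq : B q.
  apply: (sa_add saB); last exact: (sa_opp saB).
  by apply: (sa_add saB); [exact: sa_one | exact: (sa_opp saB)].
have qa : q^t* = q by rewrite !adjB !(mu_adj muv) adj1.
have ii : v i i *m v i i = v i i by rewrite (mu_mul muv) !eqxx.
have kk : v k k *m v k k = v k k by rewrite (mu_mul muv) !eqxx.
have ik0 : v i i *m v k k = 0 by rewrite (mu_mul muv) ikf andbF.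
have ki0 : v k k *m v i i = 0 by rewrite (mu_mul muv) kif andbF.
have iq : v i i *m q = 0 by rewrite !mulmxBr mulmx1 ii ik0 subrr subr0.
have kq : v k k *m q = 0 by rewrite !mulmxBr mulmx1 kk ki0 subr0 subrr.
have qi : q *m v i i = 0 by rewrite !mulmxBl mul1mx ii ki0 subrr subr0.
have qk : q *m v k k = 0 by rewrite !mulmxBl mul1mx kk ik0 subr0 subrr.
have qq : q *m q = q by rewrite {1}/q !mulmxBl mul1mx iq kq !subr0.
have ufq y w : y^* * y = 1 -> w^* * w = 1 ->
    v i i + y *: v k k + w *: q \is unitarymx.
  move=> yy ww; apply: unitaryP; rewrite !adjD !adjZ !(mu_adj muv) qa.
  rewrite !mulmxDl !mulmxDr -!scalemxAl -!scalemxAr !scalerA.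
  rewrite ii kk ik0 ki0 iq kq qi qk qq yy ww !scale1r !scaler0 !addr0 !add0r.
  by rewrite /q; move: (v i i) (v k k) => a b; apply/matrixP => x z; rewrite !mxE; ring.
have Buq y w : B (v i i + y *: v k k + w *: q).
  apply: (sa_add saB); last exact: (sa_scale saB).
  by apply: (sa_add saB) => //; exact: (sa_scale saB).
pose a := f (v i i) (v k k); pose b := f (v k k) (v i i).
pose A := f (v i i) (v i i) + f (v k k) (v k k) + f q q.
have H y : y^* * y = 1 -> A + y * a + y^* * b = 0.
  move=> yy.
  have w1 : (1 : C)^* * 1 = 1 by rewrite conjC1 mulr1.
  have wN1 : (-1 : C)^* * -1 = 1 by rewrite rmorphN1 mulrNN mulr1.
  have E1 := f0 _ (Buq y 1) (ufq y 1 yy w1).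
  have E2 := f0 _ (Buq y (-1)) (ufq y (-1) yy wN1).
  move: E1 E2; rewrite !(sesquiDl sf) !(sesquiDr sf) !(sesquiZl sf) !(sesquiZr sf).
  rewrite conjC1 rmorphN1 => E1 E2.
  apply: (@mulfI _ 2%:R); first by rewrite pnatr_eq0.
  have -> : A = f (v i i) (v i i) + y^* * y * f (v k k) (v k k) + f q q.
    by rewrite yy mul1r.
  rewrite mulr0 -[RHS]addr0 -{1}E1 -{1}E2 /a /b.
  by ring.
have H1 : A + a + b = 0 by rewrite -[a]mul1r -[b]mul1r -{2}conjC1 H // conjC1 mulr1.
have H2 : A - a - b = 0.
  have := H (-1); rewrite rmorphN1 => h; rewrite -[RHS]h ?mulrNN ?mulr1 //.
  by ring.
have H3 : A + 'i * a - 'i * b = 0.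
  rewrite -[RHS](H 'i) ?conjCi; first by ring.
  by rewrite mulNr -expr2 sqrCi opprK.
apply: (@mulfI _ ('i * 2%:R)); first by rewrite mulf_neq0 ?neq0Ci // pnatr_eq0.
rewrite mulr0 -/a.
transitivity ('i * (A + a + b) + (A + 'i * a - 'i * b)
  - ('i + 1) / 2%:R * ((A + a + b) + (A - a - b))).
  by field.
by rewrite H1 H2 H3; ring.
Qed.

Lemma unitary_null_off f i j k l : unitary_null f -> c i = c j -> c k = c l ->
  i != k -> j != l -> f (v i j) (v k l) = 0.
Proof.
move=> nf cij ckl ik jl.
(* A block permutation with [s j = i] and [s l = k]: the first transposition sends [j] to [i] and
   [l] to [l'], the second sends [l'] to [k] and leaves [i] alone. *)
pose l' := tperm j i l; pose s := (tperm j i * tperm l' k)%g.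
have sj : s j = i.
  rewrite permM tpermL tpermD //; last by rewrite eq_sym.
  by rewrite /l' -{2}(tpermL j i) (inj_eq perm_inj) eq_sym.
have sl : s l = k by rewrite permM tpermL.
have sP : class_perm s.
  have jiP := class_perm_tperm (esym cij).
  apply: class_permM => //; apply: class_perm_tperm.
  by rewrite ckl; exact: (class_permP _ jiP).
have := unitary_null_diag
  (unitary_null_mull (perm_units_in s) (perm_units_unitary sP) nf) jl.
by rewrite !perm_units_mul // sj sl.
Qed.

(** Apply [unitary_null_off] to [f] rotated in rows [i] and [k]. The terms with distinct rows and
    distinct columns vanish, and the other two enter with opposite coefficients. *)
Lemma unitary_null_row f i k j l : unitary_null f ->
  c i = c k -> c i = c j -> c i = c l -> j != l ->
  f (v i j) (v i l) = f (v k j) (v k l).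
Proof.
move=> nf cik cij cil jl; have [<- //|ik] := eqVneq i k; have [sf _] := nf.
have := unitary_null_off
  (unitary_null_mull (rotation_in i k) (rotation_unitary ik cik) nf) cij
  (etrans (esym cik) cil) ik jl.
rewrite (rotation_mul _ ik cik).1 (rotation_mul _ ik cik).2.
rewrite !(sesquiDl sf) !(sesquiBr _ _ _ sf) !(sesquiZl sf) !(sesquiZr sf).
rewrite (unitary_null_off nf cij (etrans (esym cik) cil) ik jl).
rewrite (unitary_null_off nf (etrans (esym cik) cij) cil _ jl); last by rewrite eq_sym.
rewrite !rmorphM !fmorphV !rmorph_nat !mulr0 sub0r subr0 => /eqP.
rewrite addrC subr_eq0 => /eqP e; apply/esym.
apply: (@mulfI _ (3%:R / 5%:R * (4%:R / 5%:R))).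
  by rewrite !mulf_neq0 ?invr_eq0 ?pnatr_eq0.
by rewrite -[RHS]mulrA -e; ring.
Qed.

Lemma unitary_null_col f i k j l : unitary_null f ->
  c i = c k -> c i = c j -> c i = c l -> i != k ->
  f (v i j) (v k j) = f (v i l) (v k l).
Proof.
move=> nf cik cij cil ik; have [<- //|jl] := eqVneq j l; have [sf _] := nf.
have cjl : c j = c l by rewrite -cij.
have := unitary_null_off
  (unitary_null_mulr (rotation_in j l) (rotation_unitary jl cjl) nf) cij
  (etrans (esym cik) cil) ik jl.
rewrite (mul_rotation jl cjl _).1 // (mul_rotation jl cjl _).2; last by rewrite -cik.
rewrite !(sesquiBl _ _ _ sf) !(sesquiDr sf) !(sesquiZl sf) !(sesquiZr sf).
rewrite (unitary_null_off nf cij (etrans (esym cik) cil) ik jl).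
rewrite (unitary_null_off nf cil (etrans (esym cik) cij) ik); last by rewrite eq_sym.
rewrite !rmorphM !fmorphV !rmorph_nat !mulr0 add0r addr0 => /eqP.
rewrite subr_eq0 => /eqP e.
apply: (@mulfI _ (3%:R / 5%:R * (4%:R / 5%:R))).
  by rewrite !mulf_neq0 ?invr_eq0 ?pnatr_eq0.
by rewrite -[LHS]mulrA e; ring.
Qed.

(** The row identity for [f] rotated in columns [j] and [l]; its mixed terms cancel by the row
    identity for [f]. So within a block the diagonal value at [v i j] is a function of [i] plus a
    function of [j]. *)
Lemma unitary_null_square f i k j l : unitary_null f ->
  c i = c k -> c i = c j -> c i = c l ->
  f (v i j) (v i j) - f (v i l) (v i l) = f (v k j) (v k j) - f (v k l) (v k l).
Proof.
move=> nf cik cij cil; have [<-|jl] := eqVneq j l; first by rewrite !subrr.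
have [sf _] := nf; have cjl : c j = c l by rewrite -cij.
have := unitary_null_row
  (unitary_null_mulr (rotation_in j l) (rotation_unitary jl cjl) nf) cik cij cil jl.
have ckj : c k = c j by rewrite -cik.
rewrite !(mul_rotation jl cjl _).1 // !(mul_rotation jl cjl _).2 //.
rewrite !(sesquiBl _ _ _ sf) !(sesquiDr sf) !(sesquiZl sf) !(sesquiZr sf).
rewrite (unitary_null_row nf cik cij cil jl) (unitary_null_row nf cik cil cij);
  last by rewrite eq_sym.
rewrite !rmorphM !fmorphV !rmorph_nat => e.
apply: (@mulfI _ (3%:R / 5%:R * (4%:R / 5%:R))).
  by rewrite !mulf_neq0 ?invr_eq0 ?pnatr_eq0.
move: e; set x1 := f (v k j) (v k l); set x2 := f (v k l) (v k j).
move: x1 x2 (f (v i j) (v i j)) (f (v i l) (v i l)) (f (v k j) (v k j)) (f (v k l)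
  (v k l)).
move: (3%:R / 5%:R) (4%:R / 5%:R) => a b x1 x2 y1 y2 y3 y4 e.
apply: (addrI (a * a * x1 - b * b * x2)).
by apply: etrans (etrans _ e) _; ring.
Qed.

Theorem unitary_null_channel f (I : finType) (K : I -> 'M[C]_n) :
  unitary_null f -> (forall a, B (K a)) ->
  \sum_a (K a)^t* *m K a = 1%:M -> \sum_a K a *m (K a)^t* = 1%:M ->
  \sum_a f (K a) (K a) = 0.
Proof.
move=> nf BK Ku Kt; have [sf f0] := nf.
(* On matrix units [f x y] is the sum of a linear function of [x^* y] and a
   linear function of [y x^*]. *)
pose phi x := \sum_j f (v (c j) j) (v (c j) j *m x).
pose psi y := \sum_i (f (v i (c i)) (y *m v i (c i))
  - f (v (c i) (c i)) (v (c i) i *m (y *m v i (c i)))).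
have phiD x y : phi (x + y) = phi x + phi y.
  by rewrite -big_split; apply: eq_bigr => j _; rewrite mulmxDr (sesquiDr sf).
have phiZ a x : phi (a *: x) = a * phi x.
  by rewrite mulr_sumr; apply: eq_bigr => j _; rewrite -scalemxAr (sesquiZr sf).
have psiD x y : psi (x + y) = psi x + psi y.
  rewrite -big_split; apply: eq_bigr => j _ /=.
  by rewrite mulmxDl mulmxDr !(sesquiDr sf) opprD addrACA.
have psiZ a x : psi (a *: x) = a * psi x.
  rewrite mulr_sumr; apply: eq_bigr => j _.
  by rewrite -scalemxAl -scalemxAr !(sesquiZr sf) mulrBr.
have phi0 : phi 0 = 0 by rewrite -(scale0r 0) phiZ mul0r.
have psi0 : psi 0 = 0 by rewrite -(scale0r 0) psiZ mul0r.
pose g x y := f x y - (phi (x^t* *m y) + psi (y *m x^t*)).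
have sg : sesquilinear g.
  split=> [x y z|x y z|a x z|a x z]; rewrite /g.
  - by rewrite (sesquiDl sf) adjD mulmxDl mulmxDr phiD psiD; ring.
  - by rewrite (sesquiDr sf) mulmxDl mulmxDr phiD psiD; ring.
  - by rewrite (sesquiZl sf) adjZ -scalemxAl -scalemxAr phiZ psiZ; ring.
  - by rewrite (sesquiZr sf) -scalemxAl -scalemxAr phiZ psiZ; ring.
have phiE j l : c j = c l -> phi (v j l) = f (v (c j) j) (v (c j) l).
  move=> cjl; rewrite /phi (bigD1 j) //= big1 ?addr0.
    by rewrite (mu_mul muv) (mu_rep muv) !eqxx.
  by move=> a /negPf aj; rewrite (mu_mul muv) aj andbF (sesqui0r _ sf).
have psiE k i : c k = c i -> psi (v k i) = f (v i (c i)) (v k (c i))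
    - (if i == k then f (v (c i) (c i)) (v (c i) (c i)) else 0).
  move=> cki; rewrite /psi (bigD1 i) //= big1 ?addr0.
    rewrite (mu_mul muv) cki !eqxx (mu_mul muv) (mu_rep muv) !eqxx /=.
    by case: eqP => // _; rewrite (sesqui0r _ sf).
  move=> a /negPf; rewrite eq_sym => ai.
  by rewrite (mu_mul muv) ai andbF mulmx0 !(sesqui0r _ sf) subr0.
have gv i j k l : g (v i j) (v k l) = 0.
  rewrite /g (mu_adj muv) !(mu_mul muv).
  have [cij|cij] := eqVneq (c i) (c j); last first.
    rewrite (mu_off muv cij) (sesqui0l _ sf) /= phi0.
    have [-> |] := eqVneq l j; last by rewrite andbF psi0 addr0 subr0.
    case: (c k =P c j) => [ckj|]; last by rewrite psi0 addr0 subr0.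
    by rewrite (mu_off muv) ?ckj 1?eq_sym // psi0 addr0 subr0.
  have [ckl|ckl] := eqVneq (c k) (c l); last first.
    rewrite (mu_off muv ckl) (sesqui0r _ sf) psi0 /=.
    have [ik|] := eqVneq i k; last by rewrite phi0 addr0 subr0.
    by rewrite (mu_off muv) -?cij ?ik // phi0 addr0 subr0.
  have [ik|ik] := eqVneq i k; have [lj|lj] := eqVneq l j => /=.
  - subst k l; rewrite phiE // psiE // eqxx cij.
    have := @unitary_null_square f i (c j) j (c j) nf.
    rewrite (mu_rep muv) => /(_ cij cij cij) e.
    by apply/eqP; rewrite subr_eq0 addrCA -e [eqbRHS]addrC subrK.
  - subst k; rewrite psi0 addr0 phiE -?cij //.
    rewrite (@unitary_null_row f i (c i)) ?subrr ?(mu_rep muv) //.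
    by rewrite eq_sym.
  - subst l; rewrite phi0 add0r psiE ?ckl // (negPf ik) subr0.
    rewrite (@unitary_null_col f i k j (c i)) ?subrr ?(mu_rep muv) //.
    by rewrite ckl.
  - by rewrite phi0 psi0 addr0 subr0 unitary_null_off // eq_sym.
have gB x y : B x -> B y -> g x y = 0.
  move=> /(mu_span muv)[bx ->] /(mu_span muv)[b_y ->].
  rewrite (sesqui_suml _ _ _ sg) big1 // => i _;
    rewrite (sesqui_suml _ _ _ sg) big1 // => j _.
  rewrite (sesqui_sumr _ _ _ sg) big1 // => k _;
    rewrite (sesqui_sumr _ _ _ sg) big1 // => l _.
  by rewrite (sesquiZl sg) (sesquiZr sg) gv !mulr0.
have fE x y : B x -> B y -> f x y = phi (x^t* *m y) + psi (y *m x^t*).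
  by move=> Bx By; apply/eqP; rewrite -subr_eq0; apply/eqP/gB.
under eq_bigr => a _ do rewrite fE //.
rewrite big_split /=.
rewrite -(big_morph phi phiD phi0) -(big_morph psi psiD psi0) Ku Kt.
have B1 : B 1%:M by exact: sa_one.
have := fE _ _ B1 B1; rewrite adj1 mulmx1 => <-; apply: f0 => //.
by apply: unitaryP; rewrite adj1 mulmx1.
Qed.

End Units.

(** * Averages of unitary conjugations *)

Section Mixtures.
Variables (C : numClosedFieldType) (n : nat) (B : 'M[C]_n -> Prop).

Definition conjugation (U X : 'M[C]_n) : 'M[C]_n := U^t* *m X *m U.

Definition mixture (I : finType) (lam : I -> C) (U : I -> 'M[C]_n) X : 'M[C]_n :=
  \sum_i lam i *: conjugation (U i) X.

Definition unitary_mixture (I : finType) (lam : I -> C) (U : I -> 'M[C]_n) :=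
  [/\ forall i, 0 <= lam i, \sum_i lam i = 1, forall i, B (U i)
    & forall i, U i \is unitarymx].

Lemma conjugationM U V X : conjugation V (conjugation U X) = conjugation (U *m V) X.
Proof. by rewrite /conjugation adjM !mulmxA. Qed.

Lemma conjugation_sum I (s : seq I) (P : pred I) (F : I -> 'M[C]_n) V :
  conjugation V (\sum_(i <- s | P i) F i) = \sum_(i <- s | P i) conjugation V (F i).
Proof. by rewrite /conjugation mulmx_sumr mulmx_suml. Qed.

Lemma conjugationZ V a X : conjugation V (a *: X) = a *: conjugation V X.
Proof. by rewrite /conjugation -scalemxAr -scalemxAl. Qed.

Lemma conjugation_commute U X :
  U \is unitarymx -> X *m U = U *m X -> conjugation U X = X.
Proof. by move=> uU XU;
  rewrite /conjugation -mulmxA XU mulmxA unitary_adjL ?mul1mx. Qed.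

Lemma commute_conjugation U X :
  U \is unitarymx -> conjugation U X = X -> X *m U = U *m X.
Proof. by move=> uU e; rewrite -{2}e /conjugation !mulmxA (unitarymxP uU) mul1mx. Qed.

Lemma mixture_prod (I J : finType) (lam : I -> C) (mu : J -> C) U V X :
  mixture mu V (mixture lam U X) =
  mixture (fun q : I * J => lam q.1 * mu q.2) (fun q => U q.1 *m V q.2) X.
Proof.
rewrite /mixture -(pair_bigA _ (fun i j => (lam i * mu j) *: conjugation (U i *m V
  j) X)).
rewrite exchange_big /=; apply: eq_bigr => j _.
rewrite conjugation_sum scaler_sumr; apply: eq_bigr => i _.
by rewrite conjugationZ scalerA mulrC conjugationM.
Qed.

Lemma unitary_mixture_prod (I J : finType) (lam : I -> C) (mu : J -> C) U V :
  star_algebra B -> unitary_mixture lam U -> unitary_mixture mu V ->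
  unitary_mixture (fun q : I * J => lam q.1 * mu q.2) (fun q => U q.1 *m V q.2).
Proof.
move=> saB [l0 l1 BU uU] [m0 m1 BV uV]; split=> [q||q|q].
- exact: mulr_ge0.
- rewrite -(pair_bigA _ (fun i j => lam i * mu j)) -l1 /=.
  by apply: eq_bigr => i _; rewrite -mulr_sumr m1 mulr1.
- exact: (sa_mul saB).
- exact: mul_unitarymx.
Qed.

End Mixtures.

(** * Averaging onto the commutant of the algebra *)

Section Averaging.
Variables (C : numClosedFieldType) (n : nat) (B : 'M[C]_n -> Prop).
Hypothesis saB : star_algebra B.
Variables (r : nat) (c : 'I_r -> 'I_r) (v : 'I_r -> 'I_r -> 'M[C]_n).
Hypothesis muv : mxunits B c v.

Let vv i : v i i *m v i i = v i i.
Proof. by rewrite (mu_mul muv) !eqxx. Qed.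

Let vv0 i j : i != j -> v i i *m v j j = 0.
Proof. by move=> /negPf ij; rewrite (mu_mul muv) ij andbF. Qed.

Definition reflection i : 'M[C]_n := 1%:M - 2%:R *: v i i.

Lemma reflection_adj i : (reflection i)^t* = reflection i.
Proof. by rewrite adjB adjZ adj1 (mu_adj muv) rmorph_nat. Qed.

Lemma reflectionK i : reflection i *m reflection i = 1%:M.
Proof.
rewrite /reflection mulmxBl !mulmxBr !mul1mx !mulmx1 -!scalemxAl -!scalemxAr vv.
by move: (v i i) => a; apply/matrixP => x y; rewrite !mxE; ring.
Qed.

Lemma reflection_unitary i : reflection i \is unitarymx.
Proof. by apply: unitaryP; rewrite reflection_adj reflectionK. Qed.

Lemma reflection_in i : B (reflection i).
Proof.
apply: (sa_add saB); first exact: sa_one.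
by apply: (sa_opp saB); apply: (sa_scale saB); exact: mu_in muv _ _.
Qed.

Lemma reflection_comm i X : X *m reflection i = reflection i *m X ->
  X *m v i i = v i i *m X.
Proof.
rewrite /reflection mulmxBl mulmxBr mulmx1 mul1mx -scalemxAr -scalemxAl.
by move=> /addrI/oppr_inj/(scalerI _) ->; rewrite ?pnatr_eq0.
Qed.

Lemma comm_reflection i X : X *m v i i = v i i *m X ->
  X *m reflection i = reflection i *m X.
Proof.
move=> e.
by rewrite /reflection mulmxBl mulmxBr mulmx1 mul1mx -scalemxAr -scalemxAl e.
Qed.

(* The positive weight of the identity is what makes the average an interior
   point of the convex hull of the conjugations. *)
Definition averaging (P : 'M[C]_n -> Prop) :=
  exists (I : finType) (lam : I -> C) (U : I -> 'M[C]_n) (i0 : I),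
    [/\ unitary_mixture B lam U, U i0 = 1%:M, 0 < lam i0
      & forall X, P (mixture lam U X)].

Lemma averaging_prod (P Q : 'M[C]_n -> Prop) (J : finType) (mu : J -> C) V j0 :
  averaging P -> unitary_mixture B mu V -> V j0 = 1%:M -> 0 < mu j0 ->
  (forall X, P X -> Q (mixture mu V X)) -> averaging Q.
Proof.
move=> [I [lam [U [i0 [umU U1 lam0 PU]]]]] umV V1 mu0 PQ.
exists (I * J)%type, (fun q => lam q.1 * mu q.2), (fun q => U q.1 *m V q.2), (i0, j0).
split=> [| | |X].
- exact: unitary_mixture_prod.
- by rewrite /= U1 V1 mulmx1.
- exact: mulr_gt0.
- by rewrite -mixture_prod; exact: PQ.
Qed.

(** The mean of [X] and its conjugate by [reflection i] commutes with [v i i]. Reflections commute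
    with one another, so this preserves the commutations already obtained. *)
Lemma averaging_diag (s : seq 'I_r) :
  averaging (fun X => forall i, i \in s -> X *m v i i = v i i *m X).
Proof.
elim: s => [|i s IHs].
  exists unit, (fun=> 1), (fun=> 1%:M), tt; split=> //; split=> [_||_|_].
  - exact: ler01.
  - by rewrite big_const card_unit /= addr0.
  - exact: sa_one.
  - by apply: unitaryP; rewrite adj1 mulmx1.
apply: (averaging_prod (J := bool) (mu := fun=> 2%:R^-1)
  (V := fun b => if b then 1%:M else reflection i) (j0 := true) IHs).
- split=> [b||[]|[]].
  + by rewrite invr_ge0 ler0n.
  + by rewrite big_bool /= [RHS]splitr mul1r.
  + exact: sa_one.
  + exact: reflection_in.
  + by apply: unitaryP; rewrite adj1 mulmx1.
  + exact: reflection_unitary.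
- by [].
- by rewrite invr_gt0 ltr0n.
move=> X XP; rewrite /mixture big_bool /= -scalerDr /conjugation adj1 mul1mx mulmx1.
rewrite reflection_adj => j; rewrite inE -scalemxAl -scalemxAr.
have [->{j} _|ji /= js] := eqVneq j i; congr (_ *: _); last first.
  apply: reflection_comm; have Xj := comm_reflection (XP j js).
  have RR : reflection i *m reflection j = reflection j *m reflection i.
    apply: comm_reflection; rewrite /reflection mulmxBl mulmxBr mul1mx mulmx1.
    by rewrite -scalemxAl -scalemxAr !vv0 // eq_sym.
  rewrite (mulmxDl X) (mulmxDr _ X) Xj; congr (_ + _).
  by rewrite -(mulmxA (reflection i *m X)) RR !mulmxA -(mulmxA (reflection i)) Xj
    !mulmxA RR.
apply: reflection_comm;
  rewrite (mulmxDl X) (mulmxDr _ X) -(mulmxA (reflection i *m X)) reflectionK mulmx1.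
by rewrite !mulmxA reflectionK mul1mx addrC.
Qed.

(** Averaging over the block permutation matrices, after the diagonal step, gives a matrix commuting
    with these matrices and still with every [v i i]. Their products
    [perm_units v (tperm i j) *m v j j] are the units [v i j], which span [B]. *)
Lemma averaging_commutant : averaging (fun X => forall b, B b -> X *m b = b *m X).
Proof.
pose N : C := #|[set s | class_perm c s]|%:R.
have cp1 : class_perm c 1%g by apply/class_permP => a; rewrite perm1.
have N0 : 0 < N.
  by rewrite ltr0n card_gt0; apply/set0Pn; exists 1%g; rewrite inE.
(* Permutations that do not preserve the blocks get weight 0, with the identity as a placeholder
   unitary. *)
apply: (averaging_prod (J := {perm 'I_r})
  (mu := fun s => if class_perm c s then N^-1 else 0)
  (V := fun s => if class_perm c s then perm_units v s else 1%:M) (j0 := 1%g)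
  (averaging_diag (enum 'I_r))).
- split=> [s||s|s].
  + by case: ifP => // _; rewrite invr_ge0 ltW.
  + rewrite -big_mkcond /= sumr_const -mulr_natr /N cardsE mulVf //.
    by rewrite -(cardsE (class_perm c)) gt_eqF.
  + by case: ifP => // _; [exact: (perm_units_in saB muv) | exact: sa_one].
  + case: ifP => [|_]; first exact: (perm_units_unitary muv).
    by apply: unitaryP; rewrite adj1 mulmx1.
- by rewrite cp1 (perm_units1 muv).
- by rewrite cp1 invr_gt0.
move=> X XP.
pose Y := \sum_(s | class_perm c s) conjugation (perm_units v s) X.
have -> : mixture (fun s => if class_perm c s then N^-1 else 0)
    (fun s => if class_perm c s then perm_units v s else 1%:M) X = N^-1 *: Y.
  rewrite /mixture scaler_sumr [RHS]big_mkcond; apply: eq_bigr => s _.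
  by case: ifP; rewrite ?scale0r.
have Yv i : Y *m v i i = v i i *m Y.
  rewrite mulmx_suml mulmx_sumr; apply: eq_bigr => s sP; rewrite /conjugation.
  rewrite -mulmxA (perm_units_mul muv) // (perm_units_adj muv) !mulmxA.
  rewrite (mul_perm_units muv) ?class_permV // invgK.
  have -> : v (s i) i = v (s i) (s i) *m perm_units v s.
    by rewrite (mul_perm_units muv) // permK.
  have -> : v i (s i) = perm_units v s^-1%g *m v (s i) (s i).
    by rewrite (perm_units_mul muv) ?class_permV // permK.
  by rewrite mulmxA -(mulmxA (perm_units v s^-1%g)) XP ?mem_enum // !mulmxA.
have Yu t : class_perm c t -> Y *m perm_units v t = perm_units v t *m Y.
  move=> tP; apply: commute_conjugation; first exact: (perm_units_unitary muv).
  rewrite conjugation_sum [RHS](reindex_inj (mulgI t)) /=.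
  apply: eq_big => [s|s sP].
    apply/idP/idP => [sP|tsP]; first exact: class_permM.
    by rewrite -(mulKg t s); apply: class_permM => //; exact: class_permV.
  by rewrite conjugationM (perm_unitsM muv).
have YE i j : Y *m v i j = v i j *m Y.
  have [cij|cij] := eqVneq (c i) (c j); last by rewrite (mu_off muv cij) mul0mx mulmx0.
  have tP := class_perm_tperm cij.
  have -> : v i j = perm_units v (tperm i j) *m v j j.
    by rewrite (perm_units_mul muv) // tpermR.
  by rewrite mulmxA Yu // -mulmxA Yv !mulmxA.
move=> b /(mu_span muv)[beta ->]; rewrite -scalemxAl -scalemxAr; congr (_ *: _).
rewrite [LHS]mulmx_sumr [RHS]mulmx_suml; apply: eq_bigr => i _.
rewrite [LHS]mulmx_sumr [RHS]mulmx_suml; apply: eq_bigr => j _.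
by rewrite -scalemxAl -scalemxAr YE.
Qed.

End Averaging.

(** * Channels near the average are unitary mixtures *)

Section Perturbation.
Variables (C : numClosedFieldType) (n : nat) (B : 'M[C]_n -> Prop).
Hypothesis saB : star_algebra B.

Let T := (('I_n * 'I_n) * ('I_n * 'I_n))%type.
Let N := #|{: T}|.

(** A map flattened into its values on matrix units, so that linear spans of maps become row
    spaces. *)
Definition supervec (F : 'M[C]_n -> 'M[C]_n) : 'rV[C]_N :=
  \row_p let: ((i, j), (k, l)) := enum_val p in F (delta_mx i j) k l.

Lemma supervecE F i j k l :
  supervec F 0 (enum_rank ((i, j), (k, l))) = F (delta_mx i j) k l.
Proof. by rewrite mxE enum_rankK. Qed.

Lemma supervecP (u w : 'rV[C]_N) :
  (forall i j k l, u 0 (enum_rank (((i, j), (k, l)) : T)) =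
                   w 0 (enum_rank (((i, j), (k, l)) : T))) -> u = w.
Proof.
by move=> h; apply/rowP => p; rewrite -(enum_valK p);
  case: (enum_val p) => -[i j] [k l].
Qed.

Lemma linear_delta (F : 'M[C]_n -> 'M[C]_n) :
  (forall a X Y, F (a *: X + Y) = a *: F X + F Y) ->
  forall X, F X = \sum_i \sum_j X i j *: F (delta_mx i j).
Proof.
move=> lin.
have F0 : F 0 = 0 by have := lin (-1) 0 0; rewrite scaler0 addr0 scaleN1r addNr.
have FD Y Z : F (Y + Z) = F Y + F Z by have := lin 1 Y Z; rewrite !scale1r.
have FZ a Y : F (a *: Y) = a *: F Y by have := lin a Y 0; rewrite F0 !addr0.
move=> Y; rewrite {1}[Y]matrix_sum_delta (big_morph F FD F0).
apply: eq_bigr => i _; rewrite (big_morph F FD F0); apply: eq_bigr => j _.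
exact: FZ.
Qed.

Lemma kraus_linear (I : finType) (K : I -> 'M[C]_n) a X Y :
  kraus K (a *: X + Y) = a *: kraus K X + kraus K Y.
Proof.
rewrite scaler_sumr -big_split; apply: eq_bigr => i _ /=.
by rewrite mulmxDr mulmxDl -scalemxAr -scalemxAl.
Qed.

Lemma mixture_linear (I : finType) (lam : I -> C) (U : I -> 'M[C]_n) a X Y :
  mixture lam U (a *: X + Y) = a *: mixture lam U X + mixture lam U Y.
Proof.
rewrite scaler_sumr -big_split; apply: eq_bigr => i _ /=.
rewrite /conjugation mulmxDr mulmxDl -scalemxAr -scalemxAl scalerDr.
by rewrite !scalerA mulrC.
Qed.

(** A finite family of maximal rank: a unitary outside its span could be added and would raise the
    rank. *)
Lemma unitary_spanning_family :
  exists (m : nat) (W : 'I_m -> 'M[C]_n),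
    (forall j, B (W j) /\ W j \is unitarymx) /\
    forall u, B u -> u \is unitarymx ->
      (supervec (conjugation u) <= \matrix_j supervec (conjugation (W j)))%MS.
Proof.
pose good k := `[< exists (m : nat) (W : 'I_m -> 'M[C]_n),
  (forall j, B (W j) /\ W j \is unitarymx) /\
  \rank (\matrix_j supervec (conjugation (W j))) = k >].
have ex : exists k, good k.
  exists 0%N; apply/asboolP; exists 0%N, (fun=> 1%:M); split; first by case.
  by apply/eqP; rewrite -leqn0 rank_leq_row.
have ub k : good k -> (k <= N)%N.
  by move=> /asboolP[m [W [_ <-]]]; exact: rank_leq_col.
case: (ex_maxnP ex ub) => _ /asboolP[m [W [WP <-]]] max.
exists m, W; split=> // u Bu uu; apply: contrapT => nsub.
pose W' (j : 'I_m.+1) := if unlift ord0 j is Some j' then W j' else u.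
set M := \matrix_j _ in nsub max; pose M' := \matrix_j supervec (conjugation (W' j)).
have sMM' : (M <= M')%MS.
  apply/row_subP => j; have -> : row j M = row (lift ord0 j) M'.
    by rewrite !rowK /W' liftK.
  exact: row_sub.
have suM' : (supervec (conjugation u) <= M')%MS.
  have -> : supervec (conjugation u) = row ord0 M' by rewrite rowK /W' unlift_none.
  exact: row_sub.
have /max : good (\rank M').
  apply/asboolP; exists m.+1, W'; split=> // j; rewrite /W'.
  by case: unliftP => [j' _|_]; [exact: WP | split].
move=> rk; apply: nsub; apply: (submx_trans suM').
by rewrite -(geq_leqif (mxrank_leqif_sup sMM')).
Qed.

(** Each column of [cokermx M] is a functional vanishing on the row space of [M]. Applied to the
    maps sending [X] to [x^t* *m X *m y], it is a sesquilinear form in [x, y] that vanishes on the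
    unitaries, so [unitary_null_channel] applies. *)
Lemma kraus_in_span (I : finType) (K : I -> 'M[C]_n) m (M : 'M[C]_(m, N)) :
  (forall u, B u -> u \is unitarymx -> (supervec (conjugation u) <= M)%MS) ->
  (forall a, B (K a)) ->
  \sum_a (K a)^t* *m K a = 1%:M -> \sum_a K a *m (K a)^t* = 1%:M ->
  (supervec (kraus K) <= M)%MS.
Proof.
move=> span BK Ku Kt; have [r [c [v muv]]] := star_algebra_mxunits saB.
pose P (x y : 'M[C]_n) := supervec (fun X => x^t* *m X *m y).
have PDl x y z : P (x + y) z = P x z + P y z.
  by apply: supervecP => i j k l; rewrite /P [RHS]mxE !supervecE adjD !mulmxDl mxE.
have PDr x y z : P z (x + y) = P z x + P z y.
  by apply: supervecP => i j k l; rewrite /P [RHS]mxE !supervecE mulmxDr mxE.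
have PZl a x z : P (a *: x) z = a^* *: P x z.
  by apply: supervecP => i j k l; rewrite /P [RHS]mxE !supervecE adjZ -!scalemxAl mxE.
have PZr a x z : P z (a *: x) = a *: P z x.
  by apply: supervecP => i j k l; rewrite /P [RHS]mxE !supervecE -scalemxAr mxE.
have -> : supervec (kraus K) = \sum_a P (K a) (K a).
  apply: supervecP => i j k l; rewrite supervecE !summxE; apply: eq_bigr => a _.
  by rewrite supervecE.
rewrite submxE; apply/eqP/rowP => q; rewrite mulmx_suml summxE mxE.
apply: (unitary_null_channel saB muv (f := fun x y => (P x y *m cokermx M) 0 q)) => //.
split.
  split=> *; rewrite ?PDl ?PDr ?PZl ?PZr.
  - by rewrite mulmxDl mxE.
  - by rewrite mulmxDl mxE.
  - by rewrite -scalemxAl mxE.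
  - by rewrite -scalemxAl mxE.
by move=> u Bu uu; have := span u Bu uu; rewrite submxE => /eqP e;
  rewrite [_ *m _]e mxE.
Qed.

(** The difference of the channel and the average is a combination of the conjugations by the [W j],
    with small real coefficients of either sign. A suitable rewriting of the average gives each of
    these conjugations enough weight to absorb its coefficient. *)
Lemma near_averaging_unitary_mixture :
  (0 < n)%N -> exists (I : finType) (lam : I -> C) (U : I -> 'M[C]_n) (eps : C),
    [/\ unitary_mixture B lam U,
        forall X b, B b -> mixture lam U X *m b = b *m mixture lam U X, 0 < eps
      & forall (J : finType) (K : J -> 'M[C]_n), (forall a, B (K a)) ->
        \sum_a (K a)^t* *m K a = 1%:M -> \sum_a K a *m (K a)^t* = 1%:M ->
        (forall i j k l, `|(kraus K (delta_mx i j) - mixture lam U (delta_mx i j))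
          k l| <= eps) ->
        exists (J' : finType) (mu : J' -> C) (V : J' -> 'M[C]_n),
          unitary_mixture B mu V /\ forall X, kraus K X = mixture mu V X].
Proof.
move=> n_gt0; have [r [c [v muv]]] := star_algebra_mxunits saB.
have [I [lam [U [i0 [umU U1 lam0 Ucomm]]]]] := averaging_commutant saB muv.
have [m [W [WP Wspan]]] := unitary_spanning_family.
set M := \matrix_j _ in Wspan.
pose S : C := \sum_j \sum_k `|pinvmx M k j|.
have S0 : 0 <= S by do 2!apply: sumr_ge0 => ? _.
have [lam_ge0 lam_sum BU uU] := umU.
have m1 : 0 < m.+1%:R :> C by rewrite ltr0n.
have S1 : 0 < S + 1 by rewrite ltr_wpDl.
(* [S] bounds the columns of the pseudo-inverse, so entries of size at most this radius give
   coefficients of size at most [lam i0 / m.+1%:R]; the added 1 keeps the divisor positive. *)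
exists I, lam, U, (lam i0 / m.+1%:R / (S + 1)); split=> //.
  by rewrite !divr_gt0.
move=> J K BK Ku Kt small.
set TT := mixture lam U in small Ucomm *.
pose delta := supervec (kraus K) - supervec TT.
have sT : (supervec TT <= M)%MS.
  have -> : supervec TT = \sum_i lam i *: supervec (conjugation (U i)).
    apply: supervecP => i j k l; rewrite supervecE !summxE; apply: eq_bigr => a _.
    by rewrite [LHS]mxE [RHS]mxE supervecE.
  by apply: summx_sub => i _; apply: scalemx_sub; exact: Wspan.
have sdelta : (delta <= M)%MS.
  by apply: addmx_sub; [exact: kraus_in_span | rewrite eqmx_opp].
have deltaE i j k l : delta 0 (enum_rank (((i, j), (k, l)) : T)) =
    (kraus K (delta_mx i j) - TT (delta_mx i j)) k l.
  rewrite /delta [LHS]mxE [X in _ + X = _]mxE !supervecE.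
  by rewrite [RHS]mxE [X in _ = _ + X]mxE.
pose cf := delta *m pinvmx M.
have cfM : cf *m M = delta by rewrite mulmxKpV.
have cf_small j : `|cf 0 j| <= lam i0 / m.+1%:R.
  apply: (@le_trans _ _ (\sum_k lam i0 / m.+1%:R / (S + 1) * `|pinvmx M k j|)).
    rewrite mxE; apply: le_trans (ler_norm_sum _ _ _) _; apply: ler_sum => k _.
    rewrite normrM; apply: ler_wpM2r => //; rewrite -(enum_valK k).
    case: (enum_val k) => -[i j'] [k' l'].
    by rewrite deltaE.
  rewrite -mulr_sumr -[leRHS]mulr1 -[leLHS]mulrA; apply: ler_wpM2l.
    by rewrite ltW // divr_gt0.
  rewrite mulrC ler_pdivrMr // mul1r; apply: le_trans (_ : S <= _);
    last by rewrite lerDl ler01.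
  rewrite /S (bigD1 j) //= lerDl; apply: sumr_ge0 => ? _; exact: sumr_ge0.
have DE X : kraus K X = TT X + mixture (cf 0) W X.
  have lin a Y Z : TT (a *: Y + Z) + mixture (cf 0) W (a *: Y + Z) =
      a *: (TT Y + mixture (cf 0) W Y) + (TT Z + mixture (cf 0) W Z).
    by rewrite /TT !mixture_linear scalerDr addrACA.
  rewrite (linear_delta (@kraus_linear J K)) [RHS](linear_delta lin).
  apply: eq_bigr => i _; apply: eq_bigr => j _; congr (_ *: _).
  rewrite addrC; apply/eqP; rewrite -subr_eq; apply/eqP/matrixP => k l.
  rewrite -deltaE -cfM [LHS]mxE [RHS]summxE; apply: eq_bigr => q _.
  by rewrite [RHS]mxE [X in _ * X = _]mxE supervecE.
(* Both maps commute with the adjoint, so the conjugate coefficients represent the same difference,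
   and so does the mean of the two. *)
pose a j : C := 'Re (cf 0 j).
have DR X : kraus K X = TT X + mixture a W X.
  have TTadj Y : (TT Y)^t* = TT (Y^t*).
    rewrite adj_sum; apply: eq_bigr => i _.
    by rewrite adjZ !adjM trmxCK mulmxA (conj_Creal (ger0_real (lam_ge0 i))).
  have E : kraus K X = TT X + mixture (fun j => (cf 0 j)^*) W X.
    rewrite -{1}[X]trmxCK -kraus_adj DE adjD TTadj trmxCK; congr (_ + _).
    rewrite adj_sum; apply: eq_bigr => j _.
    by rewrite adjZ !adjM !trmxCK mulmxA.
  apply: (@scalerI _ _ 2%:R); first by rewrite pnatr_eq0.
  rewrite scaler_nat mulr2n {1}DE E scalerDr scaler_nat mulr2n addrACA; congr (_ + _).
  rewrite scaler_sumr -big_split; apply: eq_bigr => j _ /=.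
  rewrite -scalerDl scalerA /a ReE; congr (_ *: _); by field.
have a_small j : - (lam i0 / m.+1%:R) <= a j.
  have ra : a j \is Num.real by exact: Creal_Re.
  have : `|a j| <= lam i0 / m.+1%:R.
    by apply: le_trans (cf_small j); rewrite leif_normC_Re_Creal.
  by rewrite real_ler_norml // => /andP[].
have TW j X : conjugation (W j) (TT X) = TT X.
  by apply: conjugation_commute; [case: (WP j) | apply: Ucomm; case: (WP j)].
(* [TT] as [m.+1] equal copies, copy [j] followed by conjugation by [W j], which [TT] absorbs. Since
   [U i0 = 1], the [i0] term of copy [j] is conjugation by [W j], and [a j] is added to its
   weight. *)
pose mu (q : I + 'I_m * I) : C := match q with
  | inl i => lam i / m.+1%:R
  | inr (j, i) => lam i / m.+1%:R + (if i == i0 then a j else 0) end.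
pose V (q : I + 'I_m * I) := match q with
  | inl i => U i | inr (j, i) => U i *m W j end.
have VE X : kraus K X = mixture mu V X.
  rewrite DR /mixture big_sumType.
  have -> : \sum_q mu (inr q) *: conjugation (V (inr q)) X = \sum_j \sum_i
      (lam i / m.+1%:R + (if i == i0 then a j else 0)) *: conjugation (U i *m W j) X.
    by rewrite pair_bigA; apply: eq_bigr => -[].
  rewrite /mu /V.
  have -> : \sum_i (lam i / m.+1%:R) *: conjugation (U i) X = m.+1%:R^-1 *: TT X.
    by rewrite scaler_sumr; apply: eq_bigr => i _; rewrite scalerA mulrC.
  under [X in _ = _ + X]eq_bigr => j _.
    under eq_bigr => i _ do rewrite scalerDl.
    rewrite big_split /=.
    have -> : \sum_i (lam i / m.+1%:R) *: conjugation (U i *m W j) X =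
        m.+1%:R^-1 *: TT X.
      rewrite -[in RHS](TW j) conjugation_sum scaler_sumr; apply: eq_bigr => i _.
      by rewrite conjugationZ conjugationM scalerA mulrC.
    rewrite (bigD1 i0) //= eqxx U1 mul1mx big1 ?addr0; last first.
      by move=> i /negPf ->; rewrite scale0r.
    over.
  rewrite big_split /= sumr_const card_ord addrA; congr (_ + _).
  rewrite -mulrS -scaler_nat scalerA mulfV ?scale1r // gt_eqF //.
exists (I + 'I_m * I)%type, mu, V; split=> //; split.
- case=> [i|[j i]] /=; first by rewrite divr_ge0 // ltW.
  case: eqP => [->|_]; last by rewrite addr0 divr_ge0 // ltW.
  by rewrite -lerBlDl sub0r.
(* That the weights sum to 1 is read off from a diagonal entry of the value at the identity. *)
- have := VE 1%:M; rewrite /kraus; under eq_bigr do rewrite mulmx1.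
  rewrite Ku /mixture => e.
  have VU q : conjugation (V q) 1%:M = 1%:M.
    rewrite /conjugation mulmx1 unitary_adjL //; case: q => [i|[j i]] //=.
    by apply: mul_unitarymx => //; case: (WP j).
  move: e; under eq_bigr do rewrite VU.
  rewrite -scaler_suml => /matrixP/(_ (Ordinal n_gt0) (Ordinal n_gt0)).
  by rewrite !mxE eqxx mulr1.
- case=> [i|[j i]] //=; apply: (sa_mul saB) => //; by case: (WP j).
- case=> [i|[j i]] //=; apply: mul_unitarymx => //; by case: (WP j).
Qed.

End Perturbation.

(** * Polar part and spectral gap *)

Section Operators.
Variables (C : numClosedFieldType).

Lemma hsn_adj m n (A : 'M[C]_(m, n)) : hsn (A^t*) = hsn A.
Proof. by rewrite /hsn trmxCK mxtrace_mulC. Qed.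

Lemma hsn_entry m n (A : 'M[C]_(m, n)) i j : `|A i j| ^+ 2 <= hsn A.
Proof.
rewrite hsnE (bigD1 j) //= (bigD1 i) //= -addrA lerDl addr_ge0 //.
  by apply: sumr_ge0 => *; exact: exprn_ge0.
by apply: sumr_ge0 => ? _; apply: sumr_ge0 => *; exact: exprn_ge0.
Qed.

Lemma hsn_mxvec m n (A : 'M[C]_(m, n)) : hsn (mxvec A) = hsn A.
Proof.
rewrite !hsnE exchange_big [RHS]exchange_big /= big_ord1 pair_bigA /=.
rewrite (reindex _ (curry_mxvec_bij m n)) /=.
by apply: eq_bigr => -[i j] _; rewrite /= mxvecE.
Qed.

(** Taking adjoints gives [M^t* *m X = Y *m M^t*], so [Y] commutes with [H = M^t* *m M] and with its
    inverse square root [S]; the unitary [M *m S] inherits the relation from [M]. *)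
Lemma polar_intertwiner n (M : 'M[C]_n) (P : 'M[C]_n -> 'M[C]_n -> Prop) :
  M \in unitmx -> (forall X Y, P X Y -> P (X^t*) (Y^t*)) ->
  (forall X Y, P X Y -> M *m Y = X *m M) ->
  exists2 U, U \is unitarymx & forall X Y, P X Y -> U *m Y = X *m U.
Proof.
move=> Mu Padj MP; pose H := M^t* *m M.
have Hh : H^t* = H by rewrite adjM trmxCK.
have Hu : H \in unitmx.
  by rewrite unitmx_mul Mu andbT map_unitmx unitmx_tr.
have D_gt0 i : 0 < spectral_diag H 0 i.
  have := spectral_row_norm H i; have := spectral_row i Hh.
  rewrite spectral_diagE //; move: (row i _) => x xH xx.
  rewrite lt_def; apply/andP; split; last first.
    rewrite /H mulmxA -{2}[M]trmxCK -mulmxA -adjM -trace_mx11 -{1}[x *m _]trmxCK.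
    by rewrite -/(hsn _) hsn_ge0.
  apply/eqP => x0; move: xH; rewrite x0 scale0r => /(congr1 (mulmx^~ (invmx H))).
  rewrite mulmxK // mul0mx => xE; move: xx; rewrite xE mul0mx.
  by move/matrixP/(_ 0 0); rewrite !mxE eqxx => /eqP; rewrite eq_sym oner_eq0.
pose S := mxfun (fun x => (sqrtC x)^-1) H.
have Sh : S^t* = S.
  rewrite mxfun_adj; apply: mxfun_ext => i.
  by apply/conj_Creal/ger0_real; rewrite invr_ge0 sqrtC_ge0 ltW.
have SHS : S *m H *m S = 1%:M.
  rewrite -{1}(mxfun_id Hh) /S !mxfunM -(mxfun1 H); apply: mxfun_ext => i.
  rewrite -{2}(sqrtCK (spectral_diag H 0 i)) expr2 mulrA mulVf ?mul1r ?divff //.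
    by rewrite sqrtC_eq0 gt_eqF.
  by rewrite sqrtC_eq0 gt_eqF.
exists (M *m S).
  by apply: unitaryP; rewrite adjM Sh mulmxA -(mulmxA S) SHS.
move=> X Y PXY; rewrite mulmxA -(MP _ _ PXY) -!mulmxA; congr (_ *m _).
apply/esym; apply: mxfun_comm => //; rewrite /H mulmxA.
have -> : Y *m M^t* = M^t* *m X.
  by apply: adj_inj; rewrite !adjM !trmxCK; apply: MP; exact: Padj.
by rewrite -!mulmxA (MP _ _ PXY).
Qed.

(** For [v] in the left kernel, each [n%:R * |v l|] is at most [q] times the 1-norm of [v]. Summing
    over the [n] indices and using [q < 1] gives [v = 0]. *)
Lemma diag_dominant_unit n (M : 'M[C]_n) (q : C) :
  (0 < n)%N -> q < 1 ->
  (forall k l, `|M k l - n%:R * (k == l)%:R| <= q) -> M \in unitmx.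
Proof.
move=> n_gt0 q1 Mq; rewrite -row_free_unit -kermx_eq0; apply/eqP/row_matrixP => a.
rewrite row0; move: (row a _) (row_sub a (kermx M)) => v /sub_kermxP vM.
have S0 : 0 <= \sum_k `|v 0 k| by exact: sumr_ge0.
suff : \sum_k `|v 0 k| = 0.
  move/psumr_eq0P => h; apply/rowP => k; rewrite mxE; apply/eqP.
  by rewrite -normr_eq0; apply/eqP; apply: h.
have bound l : n%:R * `|v 0 l| <= q * \sum_k `|v 0 k|.
  have -> : n%:R * `|v 0 l| = `|\sum_k v 0 k * (M k l - n%:R * (k == l)%:R)|.
    under eq_bigr => k _ do rewrite mulrBr.
    rewrite sumrB (_ : \sum_k v 0 k * M k l = 0).
      rewrite sub0r normrN (bigD1 l) //= eqxx mulr1 big1 ?addr0.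
        by rewrite normrM normr_nat mulrC.
      by move=> k /negPf ->; rewrite !mulr0.
    by move/rowP: vM => /(_ l); rewrite !mxE.
  apply: le_trans (ler_norm_sum _ _ _) _; rewrite mulr_sumr; apply: ler_sum => k _.
  by rewrite normrM mulrC; apply: ler_wpM2r.
apply/eqP; apply: contraT => Sn0.
have Sp : 0 < \sum_k `|v 0 k| by rewrite lt_def Sn0.
have : \sum_(l < n) n%:R * `|v 0 l| <= \sum_(l < n) q * \sum_k `|v 0 k|.
  by apply: ler_sum => l _; exact: bound.
rewrite -mulr_sumr sumr_const card_ord -[leRHS]mulr_natl ler_pM2l ?ltr0n //.
by rewrite -[leLHS]mul1r ler_pM2r // => /(lt_le_trans q1); rewrite ltxx.
Qed.

(** * Spectral gap of a contraction *)

Section Gap.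
Variables (N : nat) (G : 'M[C]_N).
Hypothesis contr : forall x : 'rV[C]_N, hsn (x *m G) <= hsn x.

Let H := G *m G^t*.
Let Hh : H^t* = H.
Proof. by rewrite adjM trmxCK. Qed.
Let V := spectralmx H.
Let D i := spectral_diag H 0 i.
Let z (x : 'rV[C]_N) := x *m V^t*.

Lemma hsn_row (x : 'rV[C]_N) : hsn x = \sum_i `|x 0 i| ^+ 2.
Proof. by rewrite hsnE; apply: eq_bigr => j _; rewrite big_ord1. Qed.

Let hsn_z (x : 'rV[C]_N) : hsn x = \sum_i `|z x 0 i| ^+ 2.
Proof.
by rewrite -hsn_row hsn_unitaryr // trmxC_unitary spectral_unitarymx.
Qed.

Let hsn_rowM (x : 'rV[C]_N) : hsn (x *m G) = (x *m H *m x^t*) 0 0.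
Proof. by rewrite /hsn mxtrace_mulC trace_mx11 adjM !mulmxA. Qed.

Let hsn_zG (x : 'rV[C]_N) : hsn (x *m G) = \sum_i D i * `|z x 0 i| ^+ 2.
Proof.
rewrite hsn_rowM -(mxfun_id Hh) mxfun.unlock !mulmxA -/V -/(z x).
rewrite -mulmxA -{1}[V]trmxCK -adjM -/(z x) mxE; apply: eq_bigr => i _.
rewrite [X in X * _ = _](_ : _ = z x 0 i * D i); last first.
  by rewrite mul_mx_diag mxE [X in _ * X = _]mxE.
by rewrite !mxE normCK mulrAC mulrC.
Qed.

Let D_le1 i : D i <= 1.
Proof.
rewrite /D spectral_diagE // -hsn_rowM; apply: le_trans (contr _) _.
by rewrite /hsn mxtrace_mulC spectral_row_norm mxtrace1.
Qed.

Let D_ge0 i : 0 <= D i.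
Proof. by rewrite /D spectral_diagE // -hsn_rowM hsn_ge0. Qed.

(** In spectral coordinates the loss of norm is a sum of nonnegative terms [(1 - D i) |z i|^2].
    Hence the vectors of preserved norm form a linear subspace, the eigenspace of [G *m G^t*] at
    1. *)
Lemma isometricP (x : 'rV[C]_N) : hsn (x *m G) = hsn x <-> x *m (G *m G^t* - 1%:M) = 0.
Proof.
split=> [e|]; last first.
  rewrite mulmxBr mulmx1 => /eqP; rewrite subr_eq0 => /eqP e.
  by rewrite hsn_rowM e /hsn mxtrace_mulC trace_mx11.
have : \sum_i (1 - D i) * `|z x 0 i| ^+ 2 = 0.
  under eq_bigr do rewrite mulrBl mul1r.
  by rewrite sumrB -hsn_z -hsn_zG e subrr.
move/psumr_eq0P => h.
have {}h i : (1 - D i) * `|z x 0 i| ^+ 2 = 0.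
  by apply: h => // j _; rewrite mulr_ge0 ?exprn_ge0 // subr_ge0.
rewrite mulmxBr mulmx1 -/H -(mxfun_id Hh) mxfun.unlock !mulmxA -/V -/(z x).
suff -> : z x *m diag_mx (map_mx id (spectral_diag H)) = z x.
  by rewrite /z -mulmxA unitary_adjL ?mulmx1 ?subrr // spectral_unitarymx.
apply/rowP => i; rewrite mul_mx_diag mxE [X in _ * X = _]mxE -/(D i).
have /eqP := h i; rewrite mulf_eq0 expf_eq0 /= normr_eq0 subr_eq0 => /orP[/eqP
  <-|/eqP ->].
  by rewrite mulr1.
by rewrite mul0r.
Qed.

Lemma strict_contraction : exists2 lam : C, 0 <= lam < 1 &
  forall y : 'rV[C]_N, (forall x : 'rV[C]_N, hsn (x *m G) = hsn x -> y *m x^t* = 0) ->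
    hsn (y *m G) <= lam * hsn y.
Proof.
(* All factors lie in the interval from 0 excluded to 1, so their product is a positive lower bound
   for every gap [1 - D i] with [D i != 1]. *)
pose e i := if D i == 1 then 1 else 1 - D i.
have e01 i : 0 < e i <= 1.
  rewrite /e; case: eqP => [|/eqP ne]; first by rewrite ltr01 lexx.
  by rewrite subr_gt0 lt_def eq_sym ne D_le1 gerBl D_ge0.
have prod01 (P : pred 'I_N) : 0 < \prod_(i | P i) e i <= 1.
  apply: (big_ind (fun x => 0 < x <= 1)) => [|a b|i _]; rewrite ?ltr01 ?lexx //.
  move=> /andP[a0 a1] /andP[b0 b1]; rewrite mulr_gt0 //=.
  by rewrite -[leRHS]mulr1; apply: ler_pM => //; exact: ltW.
exists (1 - \prod_i e i).
  have /andP[p0 p1] := prod01 predT.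
  by rewrite subr_ge0 p1 /= ltrBlDr ltrDl.
move=> y yo; rewrite hsn_zG hsn_z mulr_sumr; apply: ler_sum => i _.
have [Di|Di] := eqVneq (D i) 1.
  suff -> : z y 0 i = 0 by rewrite normr0 expr0n !mulr0.
  have : hsn (row i V *m G) = hsn (row i V).
    rewrite hsn_rowM -spectral_diagE // -/(D i) Di /hsn mxtrace_mulC.
    by rewrite spectral_row_norm mxtrace1.
  move/yo => /matrixP/(_ 0 0); rewrite [RHS]mxE => <-.
  by rewrite !mxE; apply: eq_bigr => k _; rewrite !mxE.
apply: ler_wpM2r; first exact: exprn_ge0.
rewrite lerBrDr -lerBrDl (bigD1 i) //= {1}/e (negPf Di) -[leRHS]mulr1.
apply: ler_wpM2l; first by rewrite subr_ge0.
by have /andP[] := prod01 (predC1 i).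
Qed.

End Gap.
End Operators.

(** * The isometric part of a semigroup *)

Section Semigroup.
Variables (C : numClosedFieldType) (R : realType) (n : nat).
Variable Phi : R -> 'M[C]_n -> 'M[C]_n.
Hypothesis krausPhi : forall t, 0 <= t -> exists (m : nat) (K : 'I_m -> 'M[C]_n),
  [/\ forall X, Phi t X = kraus K X, \sum_a (K a)^t* *m K a = 1%:M
    & \sum_a K a *m (K a)^t* = 1%:M].
Hypothesis PhiD : forall s t X, 0 <= s -> 0 <= t -> Phi s (Phi t X) = Phi (s + t) X.
Implicit Types X Y Z : 'M[C]_n.

Definition isometric_part X := forall t, 0 <= t -> hsn (Phi t X) = hsn X.

Lemma inner_mxvec X Y : (mxvec Y *m (mxvec X)^t*) 0 0 = \tr (X^t* *m Y).
Proof.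
transitivity (\sum_i \sum_j Y i j * (X i j)^*).
  rewrite mxE (reindex _ (curry_mxvec_bij n n)) [RHS]pair_bigA.
  by apply: eq_bigr => -[i j] _ /=;
    rewrite [X in _ * X = _]mxE [X in _ * X^* = _]mxE !mxvecE.
rewrite exchange_big; apply: eq_bigr => j _; rewrite mxE.
by apply: eq_bigr => i _; rewrite !mxE mulrC.
Qed.

Lemma semigroup_adj t X : 0 <= t -> Phi t (X^t*) = (Phi t X)^t*.
Proof. by move=> /krausPhi[m [K [KE _ _]]]; rewrite !KE kraus_adj. Qed.

Lemma semigroup_contraction t X : 0 <= t -> hsn (Phi t X) <= hsn X.
Proof. by move=> /krausPhi[m [K [KE Ku Kt]]]; rewrite KE kraus_contraction. Qed.

Lemma semigroup_nonincreasing s t X : 0 <= s -> s <= t ->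
  hsn (Phi t X) <= hsn (Phi s X).
Proof.
move=> s0 st; rewrite -(subrK s t) -PhiD ?subr_ge0 //.
by apply: semigroup_contraction; rewrite subr_ge0.
Qed.

Lemma semigroup_linear t a X Y : 0 <= t ->
  Phi t (a *: X + Y) = a *: Phi t X + Phi t Y.
Proof. by move=> /krausPhi[m [K [KE _ _]]]; rewrite !KE kraus_linear. Qed.

Lemma isometric_part_adj X : isometric_part X -> isometric_part (X^t*).
Proof. by move=> NX t t0; rewrite semigroup_adj // !hsn_adj NX. Qed.

Lemma isometric_part_stable s X : 0 <= s -> isometric_part X -> isometric_part (Phi
  s X).
Proof. by move=> s0 NX t t0; rewrite PhiD // !NX // addr_ge0. Qed.

Lemma isometric_part_intertwine t m (K : 'I_m -> 'M[C]_n) X a : 0 <= t ->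
  (forall X, Phi t X = kraus K X) -> \sum_a (K a)^t* *m K a = 1%:M ->
  \sum_a K a *m (K a)^t* = 1%:M -> isometric_part X ->
  K a *m Phi t X = X *m K a.
Proof.
move=> t0 KE Ku Kt NX; rewrite KE; apply: kraus_isometric => //.
by rewrite -KE NX.
Qed.

Let G t : 'M[C]_(n * n) := \matrix_p mxvec (Phi t (vec_mx (delta_mx 0 p))).

Let mulG t X : 0 <= t -> mxvec X *m G t = mxvec (Phi t X).
Proof.
move=> t0; have lin := fun a X Y => @semigroup_linear t a X Y t0.
have F0 : Phi t 0 = 0 by have := lin (-1) 0 0; rewrite scaler0 addr0 scaleN1r addNr.
have FD Y Z : Phi t (Y + Z) = Phi t Y + Phi t Z by have := lin 1 Y Z; rewrite !scale1r.
have FZ a Y : Phi t (a *: Y) = a *: Phi t Y by have := lin a Y 0; rewrite F0 !addr0.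
rewrite mulmx_sum_row -{2}[X]mxvecK [X in vec_mx X]row_sum_delta linear_sum /=.
rewrite (big_morph (Phi t) FD F0) linear_sum; apply: eq_bigr => p _ /=.
by rewrite rowK [in RHS]linearZ /= FZ linearZ.
Qed.

Let Gcontr t : 0 <= t -> forall x : 'rV[C]_(n * n), hsn (x *m G t) <= hsn x.
Proof.
by move=> t0 x; rewrite -[x]vec_mxK mulG // !hsn_mxvec semigroup_contraction.
Qed.

Let A t := kermx (G t *m (G t)^t* - 1%:M).

Let AP t X : 0 <= t -> reflect (hsn (Phi t X) = hsn X) (mxvec X <= A t)%MS.
Proof.
move=> t0; rewrite -hsn_mxvec -mulG // -[hsn X in RHS]hsn_mxvec.
apply: (iffP sub_kermxP) => h; first exact/(isometricP (Gcontr t0)).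
exact: (proj1 (isometricP (Gcontr t0) _) _).
Qed.

(** The spaces [A t] decrease with [t]. At a time of minimal rank the space equals all later ones
    and lies in all earlier ones. *)
Lemma isometric_time : exists2 t1, 0 < t1 &
  forall X, hsn (Phi t1 X) = hsn X -> isometric_part X.
Proof.
pose good k := `[< exists2 t, 0 <= t & \rank (A t) = k >].
have ex : exists k, good k by exists (\rank (A 0)); apply/asboolP; exists 0.
case: (ex_minnP ex) => _ /asboolP[t1 t1_ge0 <-] minr.
(* The minimal rank may already occur at time 0; the shift yields a positive time. *)
exists (t1 + 1); first by rewrite ltr_wpDl.
have decr s t : 0 <= s -> s <= t -> (A t <= A s)%MS.
  move=> s0 st; have t0 := le_trans s0 st; apply/row_subP => i.
  rewrite -[row i _]vec_mxK; apply/AP => //.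
  apply: le_anti; rewrite semigroup_contraction //=.
  have /(AP _ t0) <- : (mxvec (vec_mx (row i (A t))) <= A t)%MS.
    by rewrite vec_mxK row_sub.
  exact: semigroup_nonincreasing.
move=> X hX t t0.
have t10 : 0 <= t1 + 1 by rewrite addr_ge0.
have t1le : t1 <= t1 + 1 by rewrite lerDl.
have X1 : (mxvec X <= A t1)%MS.
  by apply: submx_trans (decr _ _ t1_ge0 t1le); apply/AP.
apply/AP => //; apply: (submx_trans X1).
have [tt1|/ltW t1t] := leP t t1; first exact: decr.
rewrite -(geq_leqif (mxrank_leqif_sup (decr _ _ t1_ge0 t1t))).
by apply: minr; apply/asboolP; exists t.
Qed.

(** An isometry of a finite-dimensional space into itself is injective, hence onto by comparing
    ranks. *)
Lemma isometric_part_surjective t X : 0 <= t ->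
  (forall Z, hsn (Phi t Z) = hsn Z -> isometric_part Z) ->
  isometric_part X -> exists2 Z, isometric_part Z & Phi t Z = X.
Proof.
move=> t0 tN NX.
have NA Z : (mxvec Z <= A t)%MS <-> isometric_part Z.
  split=> [/(AP _ t0)|NZ]; [exact: tN | by apply/AP => //; exact: NZ].
have sAG : (A t *m G t <= A t)%MS.
  apply/row_subP => i; rewrite row_mul -[row i _]vec_mxK mulG //; apply/NA.
  by apply: isometric_part_stable => //; apply/NA; rewrite vec_mxK row_sub.
have capA : (A t :&: kermx (G t))%MS = 0.
  apply/eqP/rowV0P => x; rewrite sub_capmx -[x]vec_mxK => /andP[/(AP _ t0) e].
  move=> /sub_kermxP; rewrite mulG // => /(congr1 vec_mx); rewrite mxvecK linear0 => z.
  by move: e; rewrite z /hsn mulmx0 linear0 => /esym/hsn_eq0 ->; rewrite linear0.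
have /submxP[W WE] : (mxvec X <= A t *m G t)%MS.
  apply: (submx_trans (proj2 (NA X) NX)).
  rewrite -(geq_leqif (mxrank_leqif_sup sAG)) -(mxrank_mul_ker (A t) (G t)) capA.
  by rewrite mxrank0 addn0.
exists (vec_mx (W *m A t)); first by apply/NA; rewrite vec_mxK submxMl.
by apply: (can_inj mxvecK); rewrite -mulG // vec_mxK -mulmxA -WE.
Qed.

(** Write the test matrix as [Phi t Z]. Intertwining moves the Kraus operators past [Z], and [Kt]
    reduces the inner product of [Phi t Z] and [Phi t Y] to that of [Z] and [Y]. *)
Lemma isometric_orthogonal_stable t Y : 0 <= t ->
  (forall Z, hsn (Phi t Z) = hsn Z -> isometric_part Z) ->
  (forall X, isometric_part X -> \tr (X^t* *m Y) = 0) ->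
  forall X, isometric_part X -> \tr (X^t* *m Phi t Y) = 0.
Proof.
move=> t0 tN Yo X /(isometric_part_surjective t0 tN)[Z NZ <-].
have [m [K [KE Ku Kt]]] := krausPhi t0.
rewrite -(Yo Z NZ) [Phi t Y]KE mulmx_sumr linear_sum /=.
have E a : \tr ((Phi t Z)^t* *m ((K a)^t* *m Y *m K a)) =
    \tr (Z^t* *m Y *m (K a *m (K a)^t*)).
  have e := isometric_part_intertwine a t0 KE Ku Kt NZ.
  rewrite !mulmxA -adjM e adjM [RHS]mxtrace_mulC !mulmxA.
  by [].
under eq_bigr do rewrite E.
by rewrite -linear_sum /= -mulmx_sumr Kt mulmx1.
Qed.

Lemma orthogonal_strict_contraction t : 0 <= t ->
  (forall Z, hsn (Phi t Z) = hsn Z -> isometric_part Z) ->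
  exists2 lam : C, 0 <= lam < 1 & forall Y,
    (forall X, isometric_part X -> \tr (X^t* *m Y) = 0) ->
    hsn (Phi t Y) <= lam * hsn Y.
Proof.
move=> t0 tN; have [lam lam01 lamP] := strict_contraction (Gcontr t0).
exists lam => // Y Yo; rewrite -hsn_mxvec -mulG // -[hsn Y]hsn_mxvec; apply: lamP.
move=> x; rewrite -{1 2}[x]vec_mxK mulG // !hsn_mxvec => /tN/Yo e.
by apply/matrixP => i j; rewrite !ord1 -{1}[x]vec_mxK inner_mxvec e mxE.
Qed.

(** Conjugate traces as weights express the combination of Kraus operators through [Phi t] alone, so
    it can be estimated for any decomposition. An entry collects [n] errors of size at most
    [(2 * n)%:R^-1], hence at most 1/2. *)
Lemma small_intertwiner t : 0 <= t -> (0 < n)%N ->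
  (forall i j k l, `|(Phi t (delta_mx i j) - delta_mx i j) k l| <= (2 * n)%:R^-1) ->
  exists2 U, U \is unitarymx &
    forall X, isometric_part X -> U *m Phi t X = X *m U.
Proof.
move=> t0 n_gt0 small; have [m [K [KE Ku Kt]]] := krausPhi t0.
(* Close to [n%:R%:M] when [Phi t] is close to the identity. *)
pose M : 'M[C]_n := \matrix_(k, l) \sum_i Phi t (delta_mx i k) i l.
have ME : M = \sum_a (\tr (K a))^* *: K a.
  apply/matrixP => k l; rewrite mxE summxE; under eq_bigr do rewrite KE summxE.
  rewrite exchange_big /=; apply: eq_bigr => a _.
  rewrite mxE rmorph_sum mulr_suml; apply: eq_bigr => i _ /=.
  by rewrite mul_delta_entry !mxE.
have Mu : M \in unitmx.
  apply: (@diag_dominant_unit _ _ _ 2%:R^-1) => //.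
    by rewrite invf_lt1 ?ltr1n ?ltr0n.
  move=> k l; rewrite mxE.
  have -> : \sum_i Phi t (delta_mx i k) i l - n%:R * (k == l)%:R =
      \sum_i (Phi t (delta_mx i k) - delta_mx i k) i l.
    rewrite [RHS](eq_bigr (fun i => Phi t (delta_mx i k) i l - (k == l)%:R));
      last first.
      by move=> i _; rewrite !mxE eqxx eq_sym.
    by rewrite sumrB sumr_const card_ord mulr_natl.
  apply: le_trans (ler_norm_sum _ _ _) _.
  apply: (@le_trans _ _ (\sum_(i < n) (2 * n)%:R^-1)); first exact: ler_sum.
  rewrite sumr_const card_ord -[leLHS]mulr_natl natrM invfM mulrCA mulfV ?mulr1 //.
  by rewrite pnatr_eq0 -lt0n.
have [|X Y [NX ->]|U uU UP] := polar_intertwiner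
  (P := fun X Y => isometric_part X /\ Y = Phi t X) Mu.
- move=> X Y [NX ->]; split; first exact: isometric_part_adj.
  by rewrite semigroup_adj.
- rewrite ME mulmx_suml mulmx_sumr; apply: eq_bigr => a _.
  by rewrite -scalemxAl -scalemxAr (isometric_part_intertwine a t0 KE).
by exists U => // X NX; exact: UP.
Qed.

(** The unitaries multiply because [Phi] keeps the isometric part stable, so the relation applies
    again to the image. *)
Lemma intertwiner_mul k t U : 0 <= t -> U \is unitarymx ->
  (forall X, isometric_part X -> U *m Phi t X = X *m U) -> (forall X, Phi 0 X = X) ->
  exists2 V, V \is unitarymx &
    forall X, isometric_part X -> V *m Phi (k%:R * t) X = X *m V.
Proof.
move=> t0 uU UP Phi0; elim: k => [|k [V uV VP]].
  exists 1%:M => [|X _]; first by apply: unitaryP; rewrite adj1 mulmx1.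
  by rewrite mul0r Phi0 mul1mx mulmx1.
have kt0 : 0 <= k%:R * t by rewrite mulr_ge0.
exists (V *m U) => [|X NX]; first exact: mul_unitarymx.
rewrite -mulmxA -natr1 mulrDl mul1r addrC -PhiD // UP;
  last exact: isometric_part_stable.
by rewrite mulmxA VP // mulmxA.
Qed.

End Semigroup.

(** * Quantum dynamical semigroups *)

Local Open Scope complex_scope.
Local Open Scope sesquilinear_scope.

Section ComplexMatrices.
Local Open Scope classical_set_scope.
Variables (R : realType) (n : nat).
Local Notation C := (R[i]).

Lemma unital_channel_kraus (F : 'M[C]_n -> 'M[C]_n) : unital_channel F ->
  exists (m : nat) (K : 'I_m -> 'M[C]_n),
  [/\ forall X, F X = kraus K X, \sum_a (K a)^t* *m K a = 1%:M
    & \sum_a K a *m (K a)^t* = 1%:M].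
Proof.
move=> [lin cp un tp].
(* The quadratic form of this array is the squared modulus of the sum of the entries [v j j 0]. *)
have pos : block_psd (fun i j : 'I_n => delta_mx i j : 'M[C]_n).
  move=> v; pose s := \sum_j v j j 0.
  suff -> : \sum_i \sum_j ((v i)^t* *m delta_mx i j *m v j) 0 0 = s^* * s.
    by rewrite mulrC mul_conjC_ge0.
  rewrite rmorph_sum mulr_suml; apply: eq_bigr => i _.
  rewrite mulr_sumr; apply: eq_bigr => j _.
  by rewrite mul_delta_entry !mxE.
have [m [K KE]] := kraus_decomposition (linear_delta lin) (cp _ _ pos).
exists m, K; split=> //.
  by rewrite -un KE /kraus; apply: eq_bigr => a _; rewrite mulmx1.
apply/matrixP => i j.
have trd (M : 'M[C]_n) : \tr (delta_mx j i *m M) = M i j.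
  rewrite -[delta_mx j i]mul1mx /mxtrace.
  under eq_bigr do rewrite mul_delta_entry.
  rewrite (bigD1 j) //= big1 ?addr0 => [|k /negPf kj]; rewrite mxE.
    by rewrite eqxx mul1r.
  by rewrite kj mul0r.
rewrite -trd -[RHS]trd mulmx1 -[RHS]tp KE /kraus mulmx_sumr !linear_sum /=.
by apply: eq_bigr => a _; rewrite [RHS]mxtrace_mulC [LHS]mxtrace_mulC mulmxA.
Qed.

Lemma geometric_decay (lam h eps : C) : 0 <= lam < 1 -> 0 <= h -> 0 < eps ->
  exists k, lam ^+ k * h <= eps.
Proof.
move=> /andP[l0 l1] h0 e0.
have [r lamE] : exists r : R, lam = r%:C.
  by exists (complex.Re lam); rewrite RRe_real ?ger0_real.
have [a hE] : exists a : R, h = a%:C.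
  by exists (complex.Re h); rewrite RRe_real ?ger0_real.
have [e epsE] : exists e : R, eps = e%:C.
  by exists (complex.Re eps); rewrite RRe_real ?gtr0_real.
move: l0 l1 e0; rewrite {}lamE {}hE {}epsE lecR !ltcR => r0 r1 e0.
have : geometric a r x @[x --> \oo] --> (0 : R).
  by apply: cvg_geometric; rewrite ger0_norm.
move=> /cvgr0Pnorm_lt/(_ e e0)[k _ /(_ k (leqnn k))] /= ake.
exists k; rewrite -rmorphXn -rmorphM lecR mulrC ltW //.
exact: le_lt_trans (ler_norm _) ake.
Qed.

Lemma normc_sub_le (x y : C) (e : R) :
  `|complex.Re x - complex.Re y| <= e / 2 ->
  `|complex.Im x - complex.Im y| <= e / 2 -> `|x - y| <= e%:C.
Proof.
case: x y => a b [c d] /=; rewrite !ler_norml => /andP[h1 h2] /andP[h3 h4].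
have e0 : 0 <= e by lra.
rewrite normc_def lecR /= -[leRHS]ger0_norm // -sqrtr_sqr ler_sqrt ?sqr_ge0 //.
by nra.
Qed.

Lemma right_continuous_small (f : R -> R) (eta : R) :
  {within `[0, +oo[, continuous f} -> 0 < eta ->
  exists2 del, 0 < del & forall s, 0 <= s <= del -> `|f s - f 0| <= eta.
Proof.
move=> /continuous_within_itvcyP[_ /cvgrPdist_lt cf] eta0.
have [e /= e0 he] := cf _ eta0.
exists (e / 2); first by rewrite divr_gt0.
move=> s /andP[s0 se].
have [->|sn0] := eqVneq s 0; first by rewrite subrr normr0 ltW.
rewrite distrC ltW //; apply: he; last by rewrite lt_def sn0.
rewrite /ball_ /= sub0r normrN ger0_norm //.
by rewrite (le_lt_trans se) // ltr_pdivrMr // ltr_pMr // ltr1n.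
Qed.

(** The sum of the nonnegative thresholds serves as their common upper bound. *)
Lemma finite_threshold (I : finType) (P : I -> R -> Prop) :
  (forall i, exists2 T, 0 <= T & forall t, T <= t -> P i t) ->
  exists2 T, 0 <= T & forall i t, T <= t -> P i t.
Proof.
move=> h; have [T TP] := choice (fun i => let: ex_intro2 T T0 TP := h i in
  ex_intro (fun T => 0 <= T /\ forall t, T <= t -> P i t) T (conj T0 TP)).
exists (\sum_i T i); first by apply: sumr_ge0 => i _; case: (TP i).
move=> i t le_t; apply: (proj2 (TP i)); apply: le_trans le_t.
rewrite (bigD1 i) //= lerDl; apply: sumr_ge0 => j _; by case: (TP j).
Qed.

End ComplexMatrices.

Section QDS.
Local Open Scope classical_set_scope.
Variables (R : realType) (n : nat) (Phi : R -> 'M[R[i]]_n -> 'M[R[i]]_n).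
Local Notation C := (R[i]).
Hypothesis qds : unital_QDS Phi.
Hypothesis n_gt0 : (0 < n)%N.

Let krausPhi t : 0 <= t -> exists (m : nat) (K : 'I_m -> 'M[C]_n),
  [/\ forall X, Phi t X = kraus K X, \sum_a (K a)^t* *m K a = 1%:M
    & \sum_a K a *m (K a)^t* = 1%:M].
Proof. by case: qds => chan _ _ _ /chan/unital_channel_kraus. Qed.

Let Phi0 X : Phi 0 X = X. Proof. by case: qds. Qed.

Let PhiD s t X : 0 <= s -> 0 <= t -> Phi s (Phi t X) = Phi (s + t) X.
Proof. by case: qds => _ _ h _; exact: h. Qed.

Lemma QDS_small_time (eta : R) : 0 < eta -> exists2 del : R, 0 < del &
  forall s, 0 <= s <= del -> forall i j k l,
    `|(Phi s (delta_mx i j) - delta_mx i j) k l| <= eta%:C.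
Proof.
move=> eta0; have eta2 : 0 < eta / 2 by rewrite divr_gt0.
pose small (q : ('I_n * 'I_n) * ('I_n * 'I_n)) s :=
  `|(Phi s (delta_mx q.1.1 q.1.2) - delta_mx q.1.1 q.1.2) q.2.1 q.2.2| <= eta%:C.
(* Here the threshold variable is a reciprocal time: at [t] the property concerns the times [s] up
   to [1 / (t + 1)], so a common threshold becomes a common [del]. *)
have [q|T T0 TP] := @finite_threshold R _
    (fun q t => forall s, 0 <= s -> s * (t + 1) <= 1 -> small q s).
  case: (qds) => _ _ _ /(_ (delta_mx q.1.1 q.1.2) q.2.1 q.2.2)[cRe cIm].
  have [d1 d10 h1] := right_continuous_small cRe eta2.
  have [d2 d20 h2] := right_continuous_small cIm eta2.
  exists (d1^-1 + d2^-1); first by rewrite addr_ge0 // invr_ge0 ltW.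
  move=> t tT s s0 st1; rewrite /small.
  have t10 : 0 < t + 1.
    by apply: ltr_wpDl => //; apply: le_trans tT; rewrite addr_ge0 // invr_ge0 ltW.
  have sd (d : R) : 0 < d -> d^-1 <= t -> s <= d.
    move=> d0 dt; have : s <= (t + 1)^-1 by rewrite -[leRHS]mul1r ler_pdivlMr.
    move/le_trans; apply; rewrite invf_ple ?posrE //.
    by apply: le_trans dt _; rewrite lerDl.
  have {}h1 := h1 s; have {}h2 := h2 s.
  rewrite s0 sd //= in h1; last by apply: le_trans tT; rewrite lerDl invr_ge0 ltW.
  rewrite s0 sd //= in h2; last by apply: le_trans tT; rewrite lerDr invr_ge0 ltW.
  rewrite mxE [X in _ + X]mxE; apply: normc_sub_le.
    by have := h1 isT; rewrite Phi0.
  by have := h2 isT; rewrite Phi0.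
exists (T + 1)^-1; first by rewrite invr_gt0 ltr_wpDl.
move=> s /andP[s0 sT] i j k l.
apply: (TP ((i, j), (k, l)) T) => //.
by rewrite -ler_pdivlMr ?ltr_wpDl // mul1r.
Qed.

Let N := isometric_part Phi.
Let B (b : 'M[C]_n) := forall X, N X -> X *m b = b *m X.

Let saB : star_algebra B.
Proof. apply: commutant_star_algebra => X; exact: isometric_part_adj. Qed.

Lemma QDS_intertwiner t : 0 <= t -> exists2 V, V \is unitarymx &
  forall X, N X -> V *m Phi t X = X *m V.
Proof.
move=> t0; have eta0 : 0 < (2 * n)%:R^-1 :> R by rewrite invr_gt0 ltr0n muln_gt0.
have [del del0 small] := QDS_small_time eta0.
(* Enough equal steps to bring [s] below [del]; the successor makes [k] positive and larger than
   [t / del]. *)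
pose k := (Num.trunc (t / del)).+1; pose s := t / k%:R.
have k0 : 0 < k%:R :> R by rewrite ltr0n.
have s0 : 0 <= s by rewrite divr_ge0 // ltW.
have sdel : s <= del.
  rewrite ler_pdivrMr // mulrC -ler_pdivrMr // ltW //; exact: truncnS_gt.
have [|U uU UP] := small_intertwiner krausPhi s0 n_gt0.
  move=> i j k' l; have := small s _ i j k' l; rewrite s0 sdel => /(_ isT).
  by rewrite fmorphV rmorph_nat.
have [V uV VP] := intertwiner_mul PhiD k s0 uU UP Phi0.
exists V => // X NX; rewrite -VP //; congr (_ *m Phi _ _).
by rewrite mulrC divfK // gt_eqF.
Qed.

(* Undoing the unitary implementing [Phi t] on [N] leaves a channel fixing [N],
   whose Kraus operators therefore lie in the commutant [B] of [N]. *)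
Lemma QDS_commutant_kraus t V : 0 <= t -> V \is unitarymx ->
  (forall X, N X -> V *m Phi t X = X *m V) ->
  exists (m : nat) (L : 'I_m -> 'M[C]_n),
    [/\ forall a, B (L a), \sum_a (L a)^t* *m L a = 1%:M,
        \sum_a L a *m (L a)^t* = 1%:M
      & forall X, kraus L X = V *m Phi t X *m V^t*].
Proof.
move=> t0 uV VP; have [m [K [KE Ku Kt]]] := krausPhi t0.
exists m, (fun a => K a *m V^t*); split=> [a X NX| | |X].
- have e := isometric_part_intertwine a t0 KE Ku Kt NX.
  rewrite mulmxA -e -!mulmxA; congr (_ *m _).
  by rewrite -[LHS]mul1mx -(unitary_adjL uV) -mulmxA (mulmxA V) VP // -!mulmxA
    (unitarymxP uV) mulmx1.
- under eq_bigr do rewrite adjM trmxCK -mulmxA (mulmxA _ _ (V^t*)).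
  by rewrite -mulmx_sumr -mulmx_suml Ku mul1mx (unitarymxP uV).
- under eq_bigr do rewrite adjM trmxCK mulmxA -(mulmxA (K _)) unitary_adjL // mulmx1.
  exact: Kt.
- rewrite KE /kraus mulmx_sumr mulmx_suml; apply: eq_bigr => a _.
  by rewrite adjM trmxCK !mulmxA.
Qed.

Lemma kraus_commutant_fix (J : finType) (L : J -> 'M[C]_n) X :
  \sum_a (L a)^t* *m L a = 1%:M -> (forall a, X *m L a = L a *m X) -> kraus L X = X.
Proof. by move=> Lu LX; apply: kraus_intertwine. Qed.

(** Geometric decay along multiples of [t1], where orthogonality to [N] persists; monotonicity of
    the norm covers the times beyond. *)
Lemma QDS_decay (eps : C) Y : 0 < eps ->
  (forall X, N X -> \tr (X^t* *m Y) = 0) ->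
  exists2 T, 0 <= T & forall t, T <= t -> hsn (Phi t Y) <= eps.
Proof.
move=> e0 Yo; have [t1 t1_gt0 t1N] := isometric_time krausPhi PhiD.
have t10 := ltW t1_gt0.
have [lam lam01 lamP] := orthogonal_strict_contraction krausPhi t10 t1N.
have [k ke] := geometric_decay lam01 (hsn_ge0 Y) e0.
have iter j : hsn (Phi (j%:R * t1) Y) <= lam ^+ j * hsn Y /\
    forall X, N X -> \tr (X^t* *m Phi (j%:R * t1) Y) = 0.
  elim: j => [|j [IH1 IH2]]; first by rewrite mul0r Phi0 mul1r.
  have jt : 0 <= j%:R * t1 by rewrite mulr_ge0.
  rewrite -natr1 mulrDl mul1r addrC -PhiD //; split.
    apply: le_trans (lamP _ IH2) _; rewrite exprS -mulrA; apply: ler_wpM2l => //.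
    by case/andP: lam01.
  exact: (isometric_orthogonal_stable krausPhi PhiD t10 t1N IH2).
exists (k%:R * t1); first by rewrite mulr_ge0.
move=> t tT; apply: le_trans ke; apply: le_trans (proj1 (iter k)).
by apply: (semigroup_nonincreasing krausPhi PhiD) => //; rewrite mulr_ge0.
Qed.

(** The neighbourhood of [T] is fixed before any time is chosen. As [kraus L] fixes the range of
    [T], the error [kraus L E - T E] is [V *m Phi t (E - T E) *m V^t*], with [E - T E] orthogonal to
    [N]. Finitely many matrix units [E] yield one [t0]. *)
Lemma QDS_eventually_mixed : exists t0 : R, 0 <= t0 /\
  forall t : R, t0 <= t -> mixed_unitary (Phi t).
Proof.
have [I [lam [U [eps [umU Tcomm eps0 near]]]]] := near_averaging_unitary_mixture
  saB n_gt0.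
have [lam_ge0 lam_sum BU uU] := umU.
set T := mixture lam U in Tcomm near.
have [t1 t1_gt0 t1N] := isometric_time krausPhi PhiD.
(* The range of [T] commutes with [B], so the corrected channel at time [t1] fixes it; [Phi t1] then
   preserves its norm, and at this time that characterizes [N]. *)
have NT X : N (T X).
  apply: t1N; have t10 := ltW t1_gt0.
  have [V uV VP] := QDS_intertwiner t10.
  have [m [L [BL Lu Lt LE]]] := QDS_commutant_kraus t10 uV VP.
  have := LE (T X); rewrite kraus_commutant_fix //; last by move=> a; exact: Tcomm.
  by move=> {2}->; rewrite hsn_unitaryr ?trmxC_unitary // hsn_unitaryl.
(* Conjugation by a unitary commuting with [N] leaves inner products with elements of [N]
   unchanged. *)
have orth E X : N X -> \tr (X^t* *m (E - T E)) = 0.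
  move=> NX; rewrite mulmxBr linearB /= [X in _ - X](_ : _ = \tr (X^t* *m E)) ?subrr //.
  rewrite mulmx_sumr linear_sum /= -[RHS]mul1r -lam_sum mulr_suml.
  apply: eq_bigr => i _; rewrite -scalemxAr mxtraceZ; congr (_ * _).
  have e : X^t* *m (U i)^t* = (U i)^t* *m X^t*.
    by rewrite -!adjM BU.
  have e' : U i *m (U i)^t* = 1%:M by exact/unitarymxP/uU.
  by rewrite /conjugation !mulmxA e -!mulmxA mxtrace_mulC -!mulmxA e' mulmx1.
(* The square is there because [hsn] is a squared norm, while the neighbourhood bounds entries by
   [eps]. *)
have [q|t0 t0_ge0 t0P] := @finite_threshold R ('I_n * 'I_n)%type
    (fun q t => hsn (Phi t (delta_mx q.1 q.2 - T (delta_mx q.1 q.2))) <= eps ^+ 2).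
  by apply: QDS_decay; [exact: exprn_gt0 | exact: orth].
exists t0; split=> // t t0t; have t_ge0 := le_trans t0_ge0 t0t.
split; first by case: qds => chan _ _ _; exact: chan.
have [V uV VP] := QDS_intertwiner t_ge0.
have [m [L [BL Lu Lt LE]]] := QDS_commutant_kraus t_ge0 uV VP.
have [|J [mu [W [[mu0 mu1 BW uW] WE]]]] := near _ L BL Lu Lt.
  move=> i j k l; set E := delta_mx i j.
  have -> : kraus L E - T E = V *m Phi t (E - T E) *m V^t*.
    have fixT : kraus L (T E) = T E.
      by apply: kraus_commutant_fix => // a; exact: Tcomm.
    have := kraus_linear L (-1) (T E) E.
    by rewrite !scaleN1r fixT -LE [E - _]addrC => ->; rewrite addrC.
  rewrite -(@ler_pXn2r _ 2) ?nnegrE //; last exact: ltW.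
  apply: le_trans (hsn_entry _ _ _) _.
  by rewrite hsn_unitaryr ?trmxC_unitary // hsn_unitaryl //; exact: (t0P (i, j)).
(* Conjugation by [V] turns the corrected channel back into [Phi t], so each unitary is multiplied
   by [V] on the right. *)
exists #|J|, (fun j => mu (enum_val j)), (fun j => W (enum_val j) *m V);
  split=> [j| |j|X].
- exact: mu0.
- by rewrite -mu1 [RHS](reindex _ (onW_bij _ (enum_val_bij J))).
- exact: mul_unitarymx.
- have -> : Phi t X = conjugation V (kraus L X).
    by rewrite LE /conjugation !mulmxA unitary_adjL // mul1mx -mulmxA unitary_adjL
      // mulmx1.
  rewrite WE conjugation_sum (reindex _ (onW_bij _ (enum_val_bij J))) /=.
  by apply: eq_bigr => j _; rewrite conjugationZ conjugationM.
Qed.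

End QDS.

Theorem theorem4p6 (R : realType) (d : nat) (Phi : R -> 'M[R[i]]_d -> 'M[R[i]]_d) :
  unital_QDS Phi ->
  exists t0 : R, 0 <= t0 /\ forall t : R, t0 <= t -> mixed_unitary (Phi t).
Proof.
(* In dimension 0 all matrices are equal and the identity with weight 1 is a mixture; positive
   dimension provides the diagonal entry from which the weights are summed. *)
case: d Phi => [|d] Phi qds; last exact: QDS_eventually_mixed.
exists 0; split=> // t t0; split; first by case: qds => chan _ _ _; exact: chan.
exists 1%N, (fun=> 1), (fun=> 1%:M); split=> [_| |_|X].
- exact: ler01.
- by rewrite big_ord1.
- by apply: unitaryP; rewrite adj1 mulmx1.
- by rewrite [LHS]flatmx0 [RHS]flatmx0.
Qed.
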